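(* For each $i\in\{0,1,2\}$ let $\mathcal{C}_i$ be the infinite ascending chain of varieties of PBZ$^*$-lattices described in the context, and for any variety $\mathbb{V}$ of PBZ$^*$-lattices let $\mathcal{C}_{i,\mathbb{V}}=\{\mathbb{V}\vee\mathbb{W}:\mathbb{W}\in\mathcal{C}_i\}$. Then, for any nontrivial subvarieties $\mathbb{V},\mathbb{W}$ of $V_{\mathbb{BZL}}(\mathbb{AOL})$ and any nontrivial subvarieties $\mathbb{U},\mathbb{Y}$ of $\mathbb{OML}$ such that $\mathbb{V}\ne\mathbb{W}$ and $\mathbb{U}\ne\mathbb{Y}$: (a) $\mathcal{C}_{0,\mathbb{V}}$ and $\mathcal{C}_{0,\mathbb{W}}$ are disjoint infinite ascending chains of subvarieties of $\mathbb{MOL}\vee V_{\mathbb{BZL}}(\mathbb{AOL})$; (b) $\mathcal{C}_{1,\mathbb{U}}$ and $\mathcal{C}_{1,\mathbb{Y}}$ are disjoint infinite ascending chains of subvarieties of $\mathbb{OML}\vee(\mathbb{MOD}\cap\mathbb{SAOL})$; (c) $\mathcal{C}_{2,\mathbb{U}}$ and $\mathcal{C}_{2,\mathbb{Y}}$ are disjoint infinite ascending chains of subvarieties of $\mathbb{OML}\vee\mathbb{DIST}$; (d) moreover, $\mathcal{C}_{1,\mathbb{U}}$ and $\mathcal{C}_{2,\mathbb{Y}}$ are disjoint, while $\mathcal{C}_{1,\mathbb{U}}$ and $\mathcal{C}_{2,\mathbb{U}}$ have in common exactly the varieties $\mathbb{U}\vee V_{\mathbb{BZL}}(\mathbf{D}_2)=\mathbb{U}\vee\mathbb{BA}=\mathbb{U}$,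 $\mathbb{U}\vee V_{\mathbb{BZL}}(\mathbf{D}_3)$ and $\mathbb{U}\vee V_{\mathbb{BZL}}(\mathbf{D}_4)$.
   Context: A BI-lattice is an algebra $(L,\wedge,\vee,\cdot',0,1)$ such that $(L,\wedge,\vee,0,1)$ is a bounded lattice and $\cdot'$ is order-reversing with $a''=a$. A pseudo-Kleene algebra is a BI-lattice with $a\wedge a'\le b\vee b'$ for all $a,b$. An ortholattice is a BI-lattice with $x\vee x'=1$ for all $x$; it is orthomodular if $a\le b$ implies $b=(b\wedge a')\vee a$. A BZ-lattice is an algebra $(L,\wedge,\vee,\cdot',\cdot^{\sim},0,1)$ such that $(L,\wedge,\vee,\cdot',0,1)$ is a pseudo-Kleene algebra and $\cdot^{\sim}$ is order-reversing with $a\wedge a^{\sim}=0$ and $a\le a^{\sim\sim}=a^{\sim\prime}$ for all $a$; $\mathbb{BZL}$ is the variety of BZ-lattices. A PBZ$^*$-lattice is a BZ-lattice satisfying $(x\wedge x')^{\sim}\approx x^{\sim}\vee x'^{\sim}$ that is paraorthomodular (if $a\le b$ and $a'\wedge b=0$, then $a=b$); PBZ$^*$-lattices form a variety. Orthomodular lattices, modular ortholattices and Boolean algebras, forming the varieties $\mathbb{OML}$, $\mathbb{MOL}$ and $\mathbb{BA}$, are regarded as PBZ$^*$-lattices with $\cdot^{\sim}=\cdot'$. $\mathbb{DIST}$, $\mathbb{MOD}$ are the varieties of PBZ$^*$-lattices with distributive, respectively modular, lattice reducts. An antiortholattice is a PBZ$^*$-lattice whose Brouwer complement $\cdot^{\sim}$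 is trivial, i.e. $0^{\sim}=1$ and $a^{\sim}=0$ for all $a\ne 0$; $\mathbb{AOL}$ is the class of antiortholattices. $V_{\mathbb{BZL}}(\mathbb{C})$ is the variety of BZ-lattices generated by $\mathbb{C}$ (for a single algebra $\mathbf{A}$ one writes $V_{\mathbb{BZL}}(\mathbf{A})$), $\vee$ between varieties is the join of varieties, $\prec$ is the cover relation between varieties, and $\mathbb{T}$ is the trivial variety. $\mathbb{SDM}$ is the variety of PBZ$^*$-lattices satisfying $(x\wedge y)^{\sim}\approx x^{\sim}\vee y^{\sim}$, and $\mathbb{SAOL}=\mathbb{SDM}\cap V_{\mathbb{BZL}}(\mathbb{AOL})$. $\mathbf{D}_n$ is the $n$-element chain with its unique involution and the trivial Brouwer complement. $\mathbf{MO}_\kappa$ ($\kappa$ a nonzero cardinal) is the modular ortholattice consisting of $0$, $1$ and $2\kappa$ pairwise incomparable elements, grouped into $\kappa$ pairs of mutual orthocomplements. For a pseudo-Kleene algebra $\mathbf{K}$, $\mathbf{D}_2\oplus\mathbf{K}\oplus\mathbf{D}_2$ is the antiortholattice obtained by adding a new bottom $0$ and a new top $1$ to $\mathbf{K}$, with the involution extending that of $\mathbf{K}$ by $0'=1$, $1'=0$, and with the trivial Brouwer complement; for a class $\mathbb{C}$, $\mathbf{D}_2\oplus\mathbb{C}\oplus\mathbf{D}_2=\{\mathbf{D}_2\oplus\mathbf{K}\oplus\mathbf{D}_2:\mathbf{K}\in\mathbb{C}\}$. For a cardinal $\kappa$, $\mathbf{D}_2^\kappa\oplus\mathbf{D}_2^\kappa$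 (respectively $\mathbf{D}_2^\kappa\oplus\mathbf{D}_2\oplus\mathbf{D}_2^\kappa$) is the ordinal sum $\mathbf{M}\oplus\mathbf{M}^d$ (respectively $\mathbf{M}\oplus\mathbf{D}_2\oplus\mathbf{M}^d$), where $\mathbf{M}$ is the Boolean lattice $\mathbf{D}_2^\kappa$, $\mathbf{M}^d$ is its dual, and each summand is stacked on the previous one with the top of the lower glued to the bottom of the upper, with the involution that interchanges $\mathbf{M}$ and $\mathbf{M}^d$ via the canonical order-reversing bijection (and interchanges the two elements of the middle $\mathbf{D}_2$, if present), and the trivial Brouwer complement. The chains are: $\mathcal{C}_0$: $\mathbb{T}\prec\mathbb{BA}=V_{\mathbb{BZL}}(\mathbf{MO}_1)\prec V_{\mathbb{BZL}}(\mathbf{MO}_2)\prec V_{\mathbb{BZL}}(\mathbf{MO}_3)\prec\dots\prec V_{\mathbb{BZL}}(\mathbf{MO}_n)\prec\dots\subsetneq V_{\mathbb{BZL}}(\mathbf{MO}_{\aleph_0})\subsetneq\mathbb{MOL}$; $\mathcal{C}_1$: $V_{\mathbb{BZL}}(\mathbf{D}_3)\prec V_{\mathbb{BZL}}(\mathbf{D}_4)=V_{\mathbb{BZL}}(\mathbf{D}_2\oplus\mathbf{MO}_1\oplus\mathbf{D}_2)\prec V_{\mathbb{BZL}}(\mathbf{D}_2\oplus\mathbf{MO}_2\oplus\mathbf{D}_2)\prec\dots\prec V_{\mathbb{BZL}}(\mathbf{D}_2\oplus\mathbf{MO}_n\oplus\mathbf{D}_2)\prec\dots\subsetneq V_{\mathbb{BZL}}(\mathbf{D}_2\oplus\mathbf{MO}_{\aleph_0}\oplus\mathbf{D}_2)\subsetneq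 V_{\mathbb{BZL}}(\mathbf{D}_2\oplus\mathbb{MOL}\oplus\mathbf{D}_2)$; $\mathcal{C}_2$: $\mathbb{T}\subsetneq\mathbb{BA}=V_{\mathbb{BZL}}(\mathbf{D}_2)\subsetneq V_{\mathbb{BZL}}(\mathbf{D}_3)=V_{\mathbb{BZL}}(\mathbf{D}_2^1\oplus\mathbf{D}_2^1)\subsetneq V_{\mathbb{BZL}}(\mathbf{D}_4)=V_{\mathbb{BZL}}(\mathbf{D}_2^1\oplus\mathbf{D}_2\oplus\mathbf{D}_2^1)\subsetneq\dots\subsetneq V_{\mathbb{BZL}}(\mathbf{D}_2^n\oplus\mathbf{D}_2^n)\subsetneq V_{\mathbb{BZL}}(\mathbf{D}_2^n\oplus\mathbf{D}_2\oplus\mathbf{D}_2^n)\subsetneq\dots\subsetneq V_{\mathbb{BZL}}(\mathbf{D}_2^{\aleph_0}\oplus\mathbf{D}_2^{\aleph_0})=V_{\mathbb{BZL}}(\mathbf{D}_2^{\aleph_0}\oplus\mathbf{D}_2\oplus\mathbf{D}_2^{\aleph_0})\subseteq\mathbb{DIST}$.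
   Formalization: C_1 is taken to begin with the trivial variety and BA=V(D_2) before V(D_3); if it began at V(D_3), U would not lie in C_{1,U}, since D_3 is not orthomodular, and (d) would fail. DIST is counted as a member of C_2. *)

(* Defs.v *)
From mathcomp Require Import all_boot all_order.
From mathcomp Require Import boolp.

Set Implicit Arguments.
Unset Strict Implicit.
Unset Printing Implicit Defensive.

Declare Scope bz_scope.
Delimit Scope bz_scope with bz.

(* Algebras of the similarity type (meet, join, ', ~, 0, 1), no axioms imposed;
   [kl] is the Kleene complement ' and [br] the Brouwer complement ~. *)
Record bzalg := BzAlg {
  car :> Type;
  meet : car -> car -> car;
  join : car -> car -> car;
  kl : car -> car;
  br : car -> car;
  bot : car;
  top : car
}.

Arguments bot {b}.
Arguments top {b}.

Notation "a ⊓ b" := (meet a b) (at level 40, left associativity) : bz_scope.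
Notation "a ⊔ b" := (join a b) (at level 50, left associativity) : bz_scope.
Notation "a ⊑ b" := (meet a b = a) (at level 70, no associativity) : bz_scope.

Local Open Scope bz_scope.

(* Classes of algebras are bare predicates: the universe of [bzalg] cannot be
   made to fit below that of [classical_sets.set] when ordinals ['I_n] occur in
   carriers. *)
Definition bzclass := bzalg -> Prop.

Definition subc (K1 K2 : bzclass) := forall A, K1 A -> K2 A.
Definition cupc (K1 K2 : bzclass) : bzclass := fun A => K1 A \/ K2 A.
Definition capc (K1 K2 : bzclass) : bzclass := fun A => K1 A /\ K2 A.
Definition properc (K1 K2 : bzclass) := subc K1 K2 /\ K1 <> K2.

Record is_hom (A B : bzalg) (f : A -> B) : Prop := {
  hom_meet : forall a b : A, f (a ⊓ b) = f a ⊓ f b;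
  hom_join : forall a b : A, f (a ⊔ b) = f a ⊔ f b;
  hom_kl : forall a : A, f (kl a) = kl (f a);
  hom_br : forall a : A, f (br a) = br (f a);
  hom_bot : f bot = bot;
  hom_top : f top = top
}.

Definition prodalg (I : Type) (F : I -> bzalg) : bzalg :=
  {| car := forall i, F i;
     meet := fun a b i => a i ⊓ b i;
     join := fun a b i => a i ⊔ b i;
     kl := fun a i => kl (a i);
     br := fun a i => br (a i);
     bot := fun i => bot;
     top := fun i => top |}.

(* Closure under homomorphic images, subalgebras (up to isomorphism) and
   arbitrary direct products. *)
Record is_variety (K : bzclass) : Prop := {
  var_H : forall (A B : bzalg) (f : A -> B),
    is_hom f -> (forall b, exists a, f a = b) -> K A -> K B;
  var_S : forall (A B : bzalg) (f : A -> B),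
    is_hom f -> (forall a1 a2, f a1 = f a2 -> a1 = a2) -> K B -> K A;
  var_P : forall (I : Type) (F : I -> bzalg),
    (forall i, K (F i)) -> K (prodalg F)
}.

Definition subvariety (V K : bzclass) := is_variety V /\ subc V K.

Record bounded_lattice (L : bzalg) : Prop := {
  bl_meetC : forall a b : L, a ⊓ b = b ⊓ a;
  bl_joinC : forall a b : L, a ⊔ b = b ⊔ a;
  bl_meetA : forall a b c : L, a ⊓ (b ⊓ c) = (a ⊓ b) ⊓ c;
  bl_joinA : forall a b c : L, a ⊔ (b ⊔ c) = (a ⊔ b) ⊔ c;
  bl_meetK : forall a b : L, a ⊓ (a ⊔ b) = a;
  bl_joinK : forall a b : L, a ⊔ (a ⊓ b) = a;
  bl_bot : forall a : L, bot ⊑ a;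
  bl_top : forall a : L, a ⊑ top
}.

Definition distributive (L : bzalg) :=
  forall a b c : L, a ⊓ (b ⊔ c) = (a ⊓ b) ⊔ (a ⊓ c).

Definition modular (L : bzalg) :=
  forall a b c : L, a ⊑ c -> a ⊔ (b ⊓ c) = (a ⊔ b) ⊓ c.

Record bi_lattice (L : bzalg) : Prop := {
  bi_lat : bounded_lattice L;
  bi_anti : forall a b : L, a ⊑ b -> kl b ⊑ kl a;
  bi_invol : forall a : L, kl (kl a) = a
}.

Record pseudo_kleene (L : bzalg) : Prop := {
  pk_bi : bi_lattice L;
  pk_kleene : forall a b : L, a ⊓ kl a ⊑ b ⊔ kl b
}.

Record ortholattice (L : bzalg) : Prop := {
  ol_bi : bi_lattice L;
  ol_compl : forall a : L, a ⊔ kl a = top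
}.

Definition orthomodular (L : bzalg) :=
  forall a b : L, a ⊑ b -> b = (b ⊓ kl a) ⊔ a.

Definition paraorthomodular (L : bzalg) :=
  forall a b : L, a ⊑ b -> kl a ⊓ b = bot -> a = b.

Record BZL (L : bzalg) : Prop := {
  bz_pk : pseudo_kleene L;
  bz_anti : forall a b : L, a ⊑ b -> br b ⊑ br a;
  bz_disj : forall a : L, a ⊓ br a = bot;
  bz_ext : forall a : L, a ⊑ br (br a);
  bz_brkl : forall a : L, br (br a) = kl (br a)
}.

Record PBZs (L : bzalg) : Prop := {
  pbz_bz : BZL L;
  pbz_star : forall a : L, br (a ⊓ kl a) = br a ⊔ br (kl a);
  pbz_pom : paraorthomodular L
}.

Definition TRIV : bzclass := fun L => forall a b : L, a = b.

Definition br_is_kl (L : bzalg) := forall a : L, br a = kl a.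

Definition OML : bzclass :=
  fun L => [/\ ortholattice L, orthomodular L & br_is_kl L].
Definition MOL : bzclass :=
  fun L => [/\ ortholattice L, modular L & br_is_kl L].
Definition BA : bzclass :=
  fun L => [/\ ortholattice L, distributive L & br_is_kl L].

Definition DIST : bzclass := fun L => PBZs L /\ distributive L.
Definition MOD : bzclass := fun L => PBZs L /\ modular L.

Definition AOL : bzclass := fun L =>
  [/\ PBZs L, br (bot : L) = top & forall a : L, a <> bot -> br a = bot].

(* Least variety of BZ-lattices containing C. *)
Definition VBZL (C : bzclass) : bzclass := fun A =>
  forall V, subvariety V BZL -> subc C V -> V A.
Definition VBZL1 (A : bzalg) : bzclass := VBZL (fun B => B = A).

Definition vjoin (V W : bzclass) : bzclass := VBZL (cupc V W).

Definition SDM : bzclass := fun L =>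
  PBZs L /\ forall a b : L, br (a ⊓ b) = br a ⊔ br b.
Definition SAOL : bzclass := capc SDM (VBZL AOL).

Definition nontrivial (V : bzclass) := exists A, V A /\ ~ TRIV A.

Definition trivial_br (T : Type) (b t : T) (x : T) : T :=
  if `[< x = b >] then t else b.

(* The n-element chain, for n >= 1. *)
Definition D (n : nat) : bzalg :=
  {| car := 'I_n.-1.+1;
     meet := Order.min;
     join := Order.max;
     kl := @rev_ord n.-1.+1;
     br := trivial_br ord0 ord_max;
     bot := ord0;
     top := ord_max |}.

(* MO_kappa, the cardinal kappa being that of the index type I: the elements
   other than 0 and 1 are the [mo_elt i b], with [mo_elt i true] and
   [mo_elt i false] mutual orthocomplements. *)
Inductive mo_car (I : Type) := mo_bot | mo_top | mo_elt of I & bool.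
Arguments mo_bot {I}.
Arguments mo_top {I}.

Section MO.
Variable I : eqType.

Definition mo_meet (x y : mo_car I) : mo_car I :=
  match x, y with
  | mo_top, z | z, mo_top => z
  | mo_elt i b, mo_elt j c => if (i == j) && (b == c) then mo_elt i b else mo_bot
  | _, _ => mo_bot
  end.

Definition mo_join (x y : mo_car I) : mo_car I :=
  match x, y with
  | mo_bot, z | z, mo_bot => z
  | mo_elt i b, mo_elt j c => if (i == j) && (b == c) then mo_elt i b else mo_top
  | _, _ => mo_top
  end.

Definition mo_compl (x : mo_car I) : mo_car I :=
  match x with
  | mo_bot => mo_top
  | mo_top => mo_bot
  | mo_elt i b => mo_elt i (~~ b)
  end.

Definition MO : bzalg :=
  {| meet := mo_meet; join := mo_join; kl := mo_compl; br := mo_compl;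
     bot := mo_bot; top := mo_top |}.
End MO.

(* D_2 (+) K (+) D_2; the Brouwer complement of K, if any, is disregarded. *)
Inductive ext_car (T : Type) := ext_bot | ext_mid of T | ext_top.
Arguments ext_bot {T}.
Arguments ext_top {T}.

Section Ext.
Variable K : bzalg.

Definition ext_meet (x y : ext_car K) : ext_car K :=
  match x, y with
  | ext_top, z | z, ext_top => z
  | ext_mid a, ext_mid b => ext_mid (a ⊓ b)
  | _, _ => ext_bot
  end.

Definition ext_join (x y : ext_car K) : ext_car K :=
  match x, y with
  | ext_bot, z | z, ext_bot => z
  | ext_mid a, ext_mid b => ext_mid (a ⊔ b)
  | _, _ => ext_top
  end.

Definition ext_kl (x : ext_car K) : ext_car K :=
  match x with
  | ext_bot => ext_top
  | ext_top => ext_bot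
  | ext_mid a => ext_mid (kl a)
  end.

Definition ext : bzalg :=
  {| meet := ext_meet; join := ext_join; kl := ext_kl;
     br := trivial_br ext_bot ext_top; bot := ext_bot; top := ext_top |}.
End Ext.

Definition ext_class (C : bzclass) : bzclass := fun A =>
  exists K, C K /\ A = ext K.

(* M = D_2^kappa is [I -> bool] with kappa the cardinality of I, and M^d is the
   same set with the order reversed. *)
Section PowerSums.
Variable I : Type.
Notation M := (I -> bool).
Implicit Types x y : M.

Definition pmeet x y : M := fun i => x i && y i.
Definition pjoin x y : M := fun i => x i || y i.
Definition p0 : M := fun=> false.
Definition p1 : M := fun=> true.

(* M (+) M^d ([pow_sum]): the glued ordinal sum of bounded lattices L and L' is the
   sublattice {(x, y) | x = 1 or y = 0} of L * L', where L is the set of all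
   (x, 0), L' the set of all (1, y), and (1, 0) is the glued point. For
   L' = M^d, the bottom of L' is [p1]. *)
Definition glued := {p : M * M | p.1 = p1 \/ p.2 = p1}.

Fact glued_meet_subproof (p q : glued) :
  (pmeet (sval p).1 (sval q).1, pjoin (sval p).2 (sval q).2).1 = p1 \/
  (pmeet (sval p).1 (sval q).1, pjoin (sval p).2 (sval q).2).2 = p1.
Proof.
case: p q => -[x y] /= hp [[z t] /= hq].
case: hp => ->; last by right; apply/funext.
case: hq => ->; first by left; apply/funext.
by right; apply/funext => i; rewrite /pjoin orbT.
Qed.

Fact glued_join_subproof (p q : glued) :
  (pjoin (sval p).1 (sval q).1, pmeet (sval p).2 (sval q).2).1 = p1 \/
  (pjoin (sval p).1 (sval q).1, pmeet (sval p).2 (sval q).2).2 = p1.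
Proof.
case: p q => -[x y] /= hp [[z t] /= hq].
case: hp => ->; first by left; apply/funext.
case: hq => ->; last by right; apply/funext.
by left; apply/funext => i; rewrite /pjoin orbT.
Qed.

Fact glued_kl_subproof (p : glued) :
  ((sval p).2, (sval p).1).1 = p1 \/ ((sval p).2, (sval p).1).2 = p1.
Proof. by case: p => -[x y] /= []; [right | left]. Qed.

Definition glued_meet (p q : glued) : glued := exist _ _ (glued_meet_subproof p q).
Definition glued_join (p q : glued) : glued := exist _ _ (glued_join_subproof p q).
Definition glued_kl (p : glued) : glued := exist _ _ (glued_kl_subproof p).
Definition glued_bot : glued := exist _ (p0, p1) (or_intror erefl).
Definition glued_top : glued := exist _ (p1, p0) (or_introl erefl).

Definition pow_sum : bzalg :=
  {| meet := glued_meet; join := glued_join; kl := glued_kl;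
     br := trivial_br glued_bot glued_top; bot := glued_bot; top := glued_top |}.

(* M (+) D_2 (+) M^d ([pow_sum2]): as D_2 has no element besides the two glued ones, this is
   M^d placed above a disjoint copy of M, the covering pair [low p1], [up p1]
   being the middle D_2. *)
Inductive stacked := low of M | up of M.

Definition stacked_meet (p q : stacked) : stacked :=
  match p, q with
  | low x, low y => low (pmeet x y)
  | low x, up _ | up _, low x => low x
  | up x, up y => up (pjoin x y)
  end.

Definition stacked_join (p q : stacked) : stacked :=
  match p, q with
  | low x, low y => low (pjoin x y)
  | low _, up y | up y, low _ => up y
  | up x, up y => up (pmeet x y)
  end.

Definition stacked_kl (p : stacked) : stacked :=
  match p with low x => up x | up x => low x end.

Definition pow_sum2 : bzalg :=
  {| meet := stacked_meet; join := stacked_join; kl := stacked_kl;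
     br := trivial_br (low p0) (up p0); bot := low p0; top := up p0 |}.
End PowerSums.

(* All three chains are taken to start with the trivial variety and
   BA = V(D_2); C2 is taken to include its upper bound DIST. *)
Definition C0 (K : bzclass) : Prop :=
  K = TRIV \/ K = BA \/
  (exists n : nat, 0 < n /\ K = VBZL1 (MO 'I_n)) \/
  K = VBZL1 (MO nat) \/ K = MOL.

Definition C1 (K : bzclass) : Prop :=
  K = TRIV \/ K = BA \/ K = VBZL1 (D 3) \/ K = VBZL1 (D 4) \/
  (exists n : nat, 0 < n /\ K = VBZL1 (ext (MO 'I_n))) \/
  K = VBZL1 (ext (MO nat)) \/ K = VBZL (ext_class MOL).

Definition C2 (K : bzclass) : Prop :=
  K = TRIV \/ K = BA \/
  (exists n : nat, 0 < n /\
     (K = VBZL1 (pow_sum 'I_n) \/ K = VBZL1 (pow_sum2 'I_n))) \/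
  K = VBZL1 (pow_sum nat) \/ K = VBZL1 (pow_sum2 nat) \/ K = DIST.

Definition join_chain (C : bzclass -> Prop) (V : bzclass) : bzclass -> Prop :=
  fun K => exists W, C W /\ K = vjoin V W.

(* "Ascending" is read as: infinite and well-ordered by inclusion. *)
Record infinite_ascending_chain (S : bzclass -> Prop) : Prop := {
  iac_total : forall K1 K2, S K1 -> S K2 -> subc K1 K2 \/ subc K2 K1;
  iac_infinite : exists s : nat -> bzclass,
    (forall n, S (s n)) /\ (forall n, properc (s n) (s n.+1));
  iac_least : forall P : bzclass -> Prop,
    (forall K, P K -> S K) -> (exists K, P K) ->
    exists K0, P K0 /\ forall K, P K -> subc K0 K
}.

Definition infinite_ascending_chain_in (X : bzclass) (S : bzclass -> Prop) :=
  infinite_ascending_chain S /\ forall K, S K -> subvariety K X.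

Definition disjoint_families (S1 S2 : bzclass -> Prop) :=
  forall K, ~ (S1 K /\ S2 K).

(* Main.v *)
From Stdlib Require List.
Require Import Defs.
From mathcomp Require Import all_boot all_order.
From mathcomp Require Import boolp.

(** By Birkhoff's theorem ([birkhoff]) a variety is determined by its
    identities, and the identities of a join are the common ones. The whole
    statement then follows from a few identities that behave differently in
    orthomodular lattices and in antiortholattices.

    Disjointness. A join remembers its components. In an orthomodular lattice
    every element is a Brouwer complement, whereas the Brouwer complements form
    the two-element algebra in an antiortholattice and a Boolean algebra in a
    distributive PBZ*-lattice. So if [s = t] holds in a nontrivial variety [U]
    of orthomodular lattices, replacing every variable [x] by [x~] gives an
    identity that also holds in the other component of the join, and that says
    [s = t] again in orthomodular lattices: [U] is the orthomodular part of the
    join ([OML_part_of_join]). Conversely the element [e], the meet of all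
    [(x /\ x')~], is 1 in orthomodular lattices, while in an antiortholattice
    it is 0 unless all variables take values in {0, 1}. So if [s = t] holds in a
    variety [V], then [s /\ e' = t /\ e'] holds in its join with any variety of
    orthomodular lattices, and this recovers [V] when [V] is a nontrivial
    subvariety of [VBZL AOL] ([VAOL_part_of_join]).

    Strictness. Two elements of [MO n] either commute or have commutator 1, and
    [n + 1] elements cannot lie in pairwise different blocks; this yields
    identities telling [MO n] from [MO (n + 1)], and the same for their
    extensions by a new bottom and top ([MO_comms_sat], [ext_MO_comms_sat]). In
    [D_2^n (+) D_2^n] there are no [n + 1] pairwise disjoint nonzero elements of
    the form [x /\ x'], and in orthomodular lattices no nonzero one
    ([tdisjoint_pow_sum], [tdisjoint_OML]).

    The common part of the last two families. The distributive law, restricted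
    to nonsharp elements by the factor [e'], holds in the join of any variety of
    orthomodular lattices with all distributive PBZ*-lattices but fails in
    [D_2 (+) MO_2 (+) D_2] ([ext_MO2_notin_DIST]). So only the part of the
    second chain below this algebra can be common, and it is matched with the
    third chain by comparing small algebras ([V_D3], [V_D4], [V_D4_ext]).

    The inclusions along the chains come from explicit embeddings and quotients,
    and each chain consists of an increasing sequence followed by finitely many
    larger varieties, hence is well-ordered; joining with a fixed variety
    preserves this ([join_well_chain]). *)

Set Implicit Arguments.
Unset Strict Implicit.
Unset Printing Implicit Defensive.

Local Open Scope bz_scope.

(** * Terms and identities *)

Inductive term (X : Type) :=
| TVar of X
| TMeet of term X & term X
| TJoin of term X & term X
| TKl of term X
| TBr of term X
| TBot
| TTop.

Arguments TBot {X}.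
Arguments TTop {X}.

Fixpoint ev (X : Type) (A : bzalg) (v : X -> A) (t : term X) : A :=
  match t with
  | TVar x => v x
  | TMeet s t => ev v s ⊓ ev v t
  | TJoin s t => ev v s ⊔ ev v t
  | TKl s => kl (ev v s)
  | TBr s => br (ev v s)
  | TBot => bot
  | TTop => top
  end.

Definition sat (K : bzclass) (X : Type) (s t : term X) :=
  forall (A : bzalg) (v : X -> A), K A -> ev v s = ev v t.

Lemma hom_ev (X : Type) (A B : bzalg) (f : A -> B) (v : X -> A) (t : term X) :
  is_hom f -> f (ev v t) = ev (fun x => f (v x)) t.
Proof.
case=> hm hj hk hb h0 h1.
by elim: t => //= [s IHs t IHt|s IHs t IHt|s IHs|s IHs];
  rewrite ?hm ?hj ?hk ?hb ?IHs ?IHt.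
Qed.

Record closed_under (A : bzalg) (P : A -> Prop) : Prop := {
  cl_meet : forall a b, P a -> P b -> P (a ⊓ b);
  cl_join : forall a b, P a -> P b -> P (a ⊔ b);
  cl_kl : forall a, P a -> P (kl a);
  cl_br : forall a, P a -> P (br a);
  cl_bot : P bot;
  cl_top : P top
}.

Definition subalg (A : bzalg) (P : A -> Prop) (cP : closed_under P) : bzalg :=
  {| car := {a | P a};
     meet := fun a b => exist _ _ (cl_meet cP (svalP a) (svalP b));
     join := fun a b => exist _ _ (cl_join cP (svalP a) (svalP b));
     kl := fun a => exist _ _ (cl_kl cP (svalP a));
     br := fun a => exist _ _ (cl_br cP (svalP a));
     bot := exist _ _ (cl_bot cP);
     top := exist _ _ (cl_top cP) |}.

Lemma subalg_inj (A : bzalg) (P : A -> Prop) (cP : closed_under P) :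
  forall a b : subalg cP, sval a = sval b -> a = b.
Proof. by move=> [a pa] [b pb] /= ab; apply: eq_exist. Qed.

Lemma subalg_hom (A : bzalg) (P : A -> Prop) (cP : closed_under P) :
  is_hom (fun a : subalg cP => sval a).
Proof. by split. Qed.

Lemma subalg_variety (K : bzclass) (A : bzalg) (P : A -> Prop)
  (cP : closed_under P) : is_variety K -> K A -> K (subalg cP).
Proof. by move=> vK; apply: (var_S vK (@subalg_hom _ _ cP)); apply: subalg_inj. Qed.

Lemma proj_hom (I : Type) (F : I -> bzalg) i :
  is_hom (fun a : prodalg F => a i).
Proof. by split. Qed.

(** For every pair of terms over the carrier of [A] that [K] does not
    identify, pick a member of [K] and a valuation separating it. In the product
    of all these algebras, the subalgebra of values of terms lies in [K]; two
    terms with the same value there are identified by [K], hence equal in [A], so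
    that evaluation in [A] is a well-defined homomorphism from it onto [A]. *)
Lemma birkhoff (K : bzclass) (A : bzalg) : is_variety K ->
  (forall s t : term A, sat K s t -> ev id s = ev id t) -> K A.
Proof.
move=> vK idA.
pose I := {p : term A * term A | ~ sat K p.1 p.2}.
have ex (p : I) : exists Bv : {B : bzalg & A -> B},
    K (projT1 Bv) /\ ev (projT2 Bv) (sval p).1 <> ev (projT2 Bv) (sval p).2.
  apply: contrapT => nex; apply: (svalP p) => B v KB; apply: contrapT => ne.
  by apply: nex; exists (existT _ B v).
pose Bv p := projT1 (cid (ex p)).
have KB p : K (projT1 (Bv p)) by case: (projT2 (cid (ex p))).
have neB p : ev (projT2 (Bv p)) (sval p).1 <> ev (projT2 (Bv p)) (sval p).2.
  by case: (projT2 (cid (ex p))).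
pose P := prodalg (fun p => projT1 (Bv p)).
pose v (a : A) : P := fun p => projT2 (Bv p) a.
pose Q (b : P) := exists t, b = ev v t.
have cQ : closed_under Q.
  split.
  - by move=> _ _ [s ->] [t ->]; exists (TMeet s t).
  - by move=> _ _ [s ->] [t ->]; exists (TJoin s t).
  - by move=> _ [s ->]; exists (TKl s).
  - by move=> _ [s ->]; exists (TBr s).
  - by exists TBot.
  - by exists TTop.
have KF : K (subalg cQ) by apply: subalg_variety => //; apply: (var_P vK).
pose tm (b : subalg cQ) := projT1 (cid (svalP b)).
have tmE b : sval b = ev v (tm b) by rewrite /tm; case: cid.
(* The two terms differ at the factor of the product indexed by themselves. *)
have key s t : ev v s = ev v t -> ev id s = ev id t.
  move=> est; apply: idA; apply: contrapT => nst.
  have := @neB (exist _ (s, t) nst) => /=; apply.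
  have ph := @proj_hom _ (fun p => projT1 (Bv p)) (exist _ (s, t) nst).
  by rewrite -(hom_ev v s ph) -(hom_ev v t ph) est.
apply: (var_H (f := fun b : subalg cQ => ev id (tm b)) vK _ _ KF).
  by split=> *; [apply: (key _ (TMeet _ _))|apply: (key _ (TJoin _ _))
    |apply: (key _ (TKl _))|apply: (key _ (TBr _))|apply: (key _ TBot)
    |apply: (key _ TTop)]; rewrite -tmE /= ?tmE.
move=> a; have Qa : Q (v a) by exists (TVar a).
by exists (exist _ (v a) Qa); apply: (key _ (TVar a)); rewrite -tmE.
Qed.

(** * Equational classes *)

Definition models (l : seq (term nat * term nat)) : bzclass := fun A =>
  forall v : nat -> A, foldr (fun e P => ev v e.1 = ev v e.2 /\ P) True l.

Lemma models_variety l : is_variety (models l).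
Proof.
split.
- move=> A B f hf surj mA v.
  pose w n := projT1 (cid (surj (v n))).
  have fw : (fun n => f (w n)) = v.
    by apply: funext => n; rewrite /w; case: cid.
  have := mA w; elim: l {mA} => //= e l IH [ew /IH fl]; split=> //.
  by rewrite -fw -!(hom_ev _ _ hf) ew.
- move=> A B f hf inj mB v.
  have := mB (fun n => f (v n)); elim: l {mB} => //= e l IH [ew /IH fl].
  by split=> //; apply: inj; rewrite !(hom_ev _ _ hf).
- move=> I F mF v.
  have hi i := mF i (fun n => v n i).
  elim: l {mF} hi => //= e l IH hi; split; last by apply: IH => i; case: (hi i).
  apply: functional_extensionality_dep => i; case: (hi i) => ei _.
  by rewrite (hom_ev v _ (@proj_hom _ F i)) ei -(hom_ev v _ (@proj_hom _ F i)).
Qed.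

Lemma capc_variety K1 K2 : is_variety K1 -> is_variety K2 ->
  is_variety (capc K1 K2).
Proof.
move=> [h1 s1 p1] [h2 s2 p2]; split.
- by move=> A B f hf sf [k1 k2]; split; [apply: h1 hf sf k1|apply: h2 hf sf k2].
- by move=> A B f hf sf [k1 k2]; split; [apply: s1 hf sf k1|apply: s2 hf sf k2].
- by move=> I F hF; split; [apply: p1|apply: p2] => i; case: (hF i).
Qed.

Lemma classext (K1 K2 : bzclass) : subc K1 K2 -> subc K2 K1 -> K1 = K2.
Proof.
by move=> h1 h2; apply: funext => A; apply: propext; split; [apply: h1|apply: h2].
Qed.

(** * Arithmetic of bounded lattices and BZ-lattices *)

Section Lattice.
Variables (L : bzalg) (bl : bounded_lattice L).
Implicit Types a b c : L.

Lemma meet_id a : a ⊓ a = a.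
Proof. by rewrite -{2}(bl_joinK bl a a) (bl_meetK bl). Qed.

Lemma le_trans b a c : a ⊑ b -> b ⊑ c -> a ⊑ c.
Proof. by move=> ab bc; rewrite -ab -(bl_meetA bl) bc. Qed.

Lemma le_anti a b : a ⊑ b -> b ⊑ a -> a = b.
Proof. by move=> ab ba; rewrite -ab (bl_meetC bl) ba. Qed.

Lemma meet_lel a b : a ⊓ b ⊑ a.
Proof. by rewrite (bl_meetC bl) (bl_meetA bl) meet_id. Qed.

Lemma meet_ler a b : a ⊓ b ⊑ b.
Proof. by rewrite -(bl_meetA bl) meet_id. Qed.

Lemma le_meet a b c : c ⊑ a -> c ⊑ b -> c ⊑ a ⊓ b.
Proof. by move=> ca cb; rewrite (bl_meetA bl) ca cb. Qed.

Lemma le_joinE a b : a ⊑ b <-> a ⊔ b = b.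
Proof.
split=> [<-|<-]; last exact: (bl_meetK bl).
by rewrite (bl_joinC bl) (bl_meetC bl) (bl_joinK bl).
Qed.

Lemma join_gel a b : a ⊑ a ⊔ b.
Proof. exact: (bl_meetK bl). Qed.

Lemma join_ger a b : b ⊑ a ⊔ b.
Proof. by rewrite (bl_joinC bl); exact: (bl_meetK bl). Qed.

Lemma join_le a b c : a ⊑ c -> b ⊑ c -> a ⊔ b ⊑ c.
Proof.
by move=> /le_joinE ac /le_joinE bc; apply/le_joinE; rewrite -(bl_joinA bl) bc.
Qed.

Lemma meet_botl a : bot ⊓ a = bot.
Proof. exact: (bl_bot bl). Qed.

Lemma meet_botr a : a ⊓ bot = bot.
Proof. by rewrite (bl_meetC bl) meet_botl. Qed.

Lemma meet_topl a : top ⊓ a = a.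
Proof. by rewrite (bl_meetC bl) (bl_top bl). Qed.

Lemma join_botl a : bot ⊔ a = a.
Proof. by apply/le_joinE/(bl_bot bl). Qed.

Lemma join_botr a : a ⊔ bot = a.
Proof. by rewrite (bl_joinC bl) join_botl. Qed.

Lemma join_topr a : a ⊔ top = top.
Proof. by apply/le_joinE/(bl_top bl). Qed.

Lemma join_topl a : top ⊔ a = top.
Proof. by rewrite (bl_joinC bl) join_topr. Qed.

Lemma le_bot a : a ⊑ bot -> a = bot.
Proof. by rewrite meet_botr. Qed.

End Lattice.

Section BiLattice.
Variables (L : bzalg) (bi : bi_lattice L).
Let bl := bi_lat bi.
Implicit Types a b c : L.

Lemma kl_meet a b : kl (a ⊓ b) = kl a ⊔ kl b.
Proof.
apply: (le_anti bl).
  rewrite -(bi_invol bi (kl a ⊔ kl b)); apply: (bi_anti bi); apply: (le_meet bl).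
    by rewrite -{2}(bi_invol bi a); apply: (bi_anti bi); exact: (join_gel bl).
  by rewrite -{2}(bi_invol bi b); apply: (bi_anti bi); exact: (join_ger bl).
by apply: (join_le bl); apply: (bi_anti bi); [exact: (meet_lel bl)|exact: (meet_ler bl)].
Qed.

Lemma kl_join a b : kl (a ⊔ b) = kl a ⊓ kl b.
Proof. by rewrite -(bi_invol bi (kl a ⊓ kl b)) kl_meet !(bi_invol bi). Qed.

Lemma kl_bot : kl (bot : L) = top.
Proof.
apply: (le_anti bl); first exact: (bl_top bl).
by have := bi_anti bi (bl_bot bl (kl top)); rewrite (bi_invol bi).
Qed.

Lemma kl_top : kl (top : L) = bot.
Proof. by rewrite -kl_bot (bi_invol bi). Qed.

End BiLattice.

Section BZLattice.
Variables (L : bzalg) (bz : BZL L).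
Let bi := pk_bi (bz_pk bz).
Let bl := bi_lat bi.
Implicit Types a b c : L.

Lemma br_top : br (top : L) = bot.
Proof. by rewrite -(meet_topl bl (br top)) (bz_disj bz). Qed.

Lemma br_bot : br (bot : L) = top.
Proof.
by rewrite -br_top; apply: (le_anti bl); [exact: (bl_top bl)|exact: (bz_ext bz)].
Qed.

Lemma br_join a b : br (a ⊔ b) = br a ⊓ br b.
Proof.
apply: (le_anti bl).
  by apply: (le_meet bl); apply: (bz_anti bz); [exact: (join_gel bl)|exact: (join_ger bl)].
apply: (le_trans bl (bz_ext bz _)); apply: (bz_anti bz); apply: (join_le bl).
  by apply: (le_trans bl (bz_ext bz _)); apply: (bz_anti bz); exact: (meet_lel bl).
by apply: (le_trans bl (bz_ext bz _)); apply: (bz_anti bz); exact: (meet_ler bl).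
Qed.

(** Brouwer complements are closed under join because
    [a~ \/ b~ = (a~ \/ b~)~~] by De Morgan for the Kleene complement, which agrees
    with the Brouwer complement on them. *)
Lemma brouwer_closed : closed_under (fun a : L => exists b, a = br b).
Proof.
split.
- by move=> _ _ [a ->] [b ->]; exists (a ⊔ b); rewrite br_join.
- move=> _ _ [a ->] [b ->]; exists (br (br a ⊔ br b)).
  by rewrite (bz_brkl bz) br_join !(bz_brkl bz) (kl_meet bi) !(bi_invol bi).
- by move=> _ [a ->]; exists (br a); rewrite (bz_brkl bz).
- by move=> _ [a ->]; exists (br a).
- by exists top; rewrite br_top.
- by exists bot; rewrite br_bot.
Qed.

End BZLattice.

Local Notation x0 := (TVar 0).
Local Notation x1 := (TVar 1).
Local Notation x2 := (TVar 2).

(** The quasi-identities stating that a complement is order-reversing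
    become identities by writing the smaller element as [x /\ y]. *)
Definition bzl_eqs : seq (term nat * term nat) :=
 [:: (TMeet x0 x1, TMeet x1 x0); (TJoin x0 x1, TJoin x1 x0);
     (TMeet x0 (TMeet x1 x2), TMeet (TMeet x0 x1) x2);
     (TJoin x0 (TJoin x1 x2), TJoin (TJoin x0 x1) x2);
     (TMeet x0 (TJoin x0 x1), x0); (TJoin x0 (TMeet x0 x1), x0);
     (TMeet TBot x0, TBot); (TMeet x0 TTop, x0);
     (TMeet (TKl x0) (TKl (TMeet x0 x1)), TKl x0);
     (TKl (TKl x0), x0);
     (TMeet (TMeet x0 (TKl x0)) (TJoin x1 (TKl x1)), TMeet x0 (TKl x0));
     (TMeet (TBr x0) (TBr (TMeet x0 x1)), TBr x0);
     (TMeet x0 (TBr x0), TBot);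
     (TMeet x0 (TBr (TBr x0)), x0);
     (TBr (TBr x0), TKl (TBr x0)) ].

Definition env (A : Type) (a b c : A) (n : nat) : A := nth c [:: a; b] n.

Lemma BZL_models : BZL = models bzl_eqs.
Proof.
apply: classext => A.
  case=> [[[bl ha hi] hk] hb hd he hn] v /=; case: (bl) => mC jC mA jA mK jK b0 t1.
  do ?split=> //.
  - by apply: ha; exact: meet_lel.
  - by apply: hb; exact: meet_lel.
move=> h; have {}h a b c := h (env a b c); rewrite /= /env /= in h.
have swap (a b : A) : a ⊑ b -> b ⊓ a = a by have := h a b a; case=> ->.
have bl : bounded_lattice A.
  by split=> [a b|a b|a b c|a b c|a b|a b|a|a];
    [have := h a b b|have := h a b b|have := h a b c|have := h a b c
    |have := h a b b|have := h a b b|have := h a a a|have := h a a a]; tauto.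
have bi : bi_lattice A.
  split=> // [a b|a]; last by have := h a a a; tauto.
  by move=> /swap <-; have := h b a b; tauto.
split=> [|a b|a|a|a]; [| |have := h a a a; tauto..].
  by split=> // a b; have := h a b a; tauto.
by move=> /swap <-; have := h b a b; tauto.
Qed.

(** * Generated varieties and joins *)

Lemma BZL_variety : is_variety BZL.
Proof. by rewrite BZL_models; exact: models_variety. Qed.

Lemma sat_variety (X : Type) (s t : term X) :
  is_variety (fun A => forall v : X -> A, ev v s = ev v t).
Proof.
split.
- move=> A B f hf surj mA v.
  pose w n := projT1 (cid (surj (v n))).
  have <- : (fun n => f (w n)) = v.
    by apply: funext => n; rewrite /w; case: cid.
  by rewrite -!(hom_ev _ _ hf) mA.
- by move=> A B f hf inj mB v; apply: inj; rewrite !(hom_ev _ _ hf).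
- move=> I F mF v; apply: functional_extensionality_dep => i.
  by rewrite (hom_ev v s (@proj_hom _ F i)) (hom_ev v t (@proj_hom _ F i)).
Qed.

Section VBZL.
Variable C : bzclass.

Lemma VBZL_gen : subc C (VBZL C).
Proof. by move=> A CA V _; apply. Qed.

Lemma VBZL_min V : subvariety V BZL -> subc C V -> subc (VBZL C) V.
Proof. by move=> hV CV A; apply. Qed.

Lemma VBZL_variety : is_variety (VBZL C).
Proof.
split.
- move=> A B f hf sf VA V hV CV; exact: (var_H (proj1 hV) hf sf (VA V hV CV)).
- move=> A B f hf jf VB V hV CV; exact: (var_S (proj1 hV) hf jf (VB V hV CV)).
- by move=> I F VF V hV CV; apply: (var_P (proj1 hV)) => i; exact: VF.
Qed.

Hypothesis CB : subc C BZL.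

Lemma VBZL_BZL : subc (VBZL C) BZL.
Proof. by apply: VBZL_min => //; split=> //; exact: BZL_variety. Qed.

Lemma VBZL_sat (X : Type) (s t : term X) : sat C s t -> sat (VBZL C) s t.
Proof.
move=> sC A v VA.
suff [_] : capc BZL (fun A => forall v : X -> A, ev v s = ev v t) A by apply.
apply: VA.
  by split; [exact: capc_variety BZL_variety (sat_variety _ _)|move=> B []].
by move=> B CB'; split; [exact: CB|move=> w; exact: sC].
Qed.

End VBZL.

Lemma VBZL_mono C1 C2 : subc C1 C2 -> subc (VBZL C1) (VBZL C2).
Proof. by move=> h A VA V hV CV; apply: VA => // B /h; exact: CV. Qed.

Lemma VBZL1_gen A : VBZL1 A A.
Proof. exact: VBZL_gen. Qed.

Lemma VBZL1_min V A : subvariety V BZL -> V A -> subc (VBZL1 A) V.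
Proof. by move=> hV VA; apply: VBZL_min => // _ ->. Qed.

Lemma VBZL1_sub A C : VBZL C A -> subc (VBZL1 A) (VBZL C).
Proof. by move=> CA B AB V hV CV; apply: AB => // _ ->; exact: CA. Qed.

Lemma vjoin_variety V W : is_variety (vjoin V W).
Proof. exact: VBZL_variety. Qed.

Lemma vjoin_l V W : subc V (vjoin V W).
Proof. by move=> A VA; apply: VBZL_gen; left. Qed.

Lemma vjoin_r V W : subc W (vjoin V W).
Proof. by move=> A VA; apply: VBZL_gen; right. Qed.

Lemma vjoin_mono V1 W1 V2 W2 : subc V1 V2 -> subc W1 W2 ->
  subc (vjoin V1 W1) (vjoin V2 W2).
Proof.
by move=> hV hW; apply: VBZL_mono => A [/hV|/hW]; [left|right].
Qed.

Lemma vjoin_min V W K : subvariety K BZL -> subc V K -> subc W K ->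
  subc (vjoin V W) K.
Proof. by move=> hK hV hW; apply: VBZL_min => // A [/hV|/hW]. Qed.

Lemma vjoin_sat V W (X : Type) (s t : term X) : subc V BZL -> subc W BZL ->
  sat V s t -> sat W s t -> sat (vjoin V W) s t.
Proof.
move=> hV hW sV sW; apply: VBZL_sat; first by move=> A [/hV|/hW].
by move=> A v [/sV|/sW].
Qed.

Lemma vjoin_absorb V W : subvariety V BZL -> subc W V -> vjoin V W = V.
Proof.
move=> hV WV; apply: classext; last exact: vjoin_l.
exact: vjoin_min.
Qed.

(** * Varieties of PBZ*-lattices *)

Lemma modular_orthomodular (L : bzalg) : ortholattice L -> modular L -> orthomodular L.
Proof.
case=> -[bl _ _] hc hm a b ab.
rewrite (bl_joinC bl) (bl_meetC bl) (hm _ _ _ ab) hc.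
by rewrite (meet_topl bl).
Qed.

Lemma distributive_modular (L : bzalg) : bounded_lattice L -> distributive L -> modular L.
Proof.
move=> bl hd a b c ac.
rewrite (bl_meetC bl (a ⊔ b)) hd (bl_meetC bl c a) ac.
by rewrite (bl_meetC bl b).
Qed.

Lemma ortho_meet_kl (L : bzalg) (a : L) : ortholattice L -> a ⊓ kl a = bot.
Proof.
case=> bi hc.
by rewrite -(bi_invol bi (a ⊓ kl a)) (kl_meet bi) hc (kl_top bi).
Qed.

Lemma ortho_BZL (L : bzalg) : ortholattice L -> br_is_kl L -> BZL L.
Proof.
move=> ol hk; case: (ol) => bi hc; have bl := bi_lat bi.
split=> [|a b|a|a|a]; rewrite ?hk.
- by split=> // a b; rewrite ortho_meet_kl // (meet_botl bl).
- exact: (bi_anti bi).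
- exact: ortho_meet_kl.
- by rewrite (bi_invol bi) (meet_id bl).
- by [].
Qed.

Lemma OML_BZL : subc OML BZL.
Proof. by move=> A [ol _ hk]; exact: ortho_BZL. Qed.

Lemma MOL_OML : subc MOL OML.
Proof. by move=> A [ol hm hk]; split=> //; exact: modular_orthomodular. Qed.

Lemma BA_MOL : subc BA MOL.
Proof.
move=> A [ol hd hk]; split=> //; apply: distributive_modular => //.
exact: (bi_lat (ol_bi ol)).
Qed.

Definition ortho_eqs : seq (term nat * term nat) :=
  [:: (TJoin x0 (TKl x0), TTop); (TBr x0, TKl x0)].
Definition modular_eq : term nat * term nat :=
  (TJoin (TMeet x0 x2) (TMeet x1 x2), TMeet (TJoin (TMeet x0 x2) x1) x2).
Definition distributive_eq : term nat * term nat :=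
  (TMeet x0 (TJoin x1 x2), TJoin (TMeet x0 x1) (TMeet x0 x2)).
Definition star_eq : term nat * term nat :=
  (TBr (TMeet x0 (TKl x0)), TJoin (TBr x0) (TBr (TKl x0))).

Lemma MOL_models : MOL = capc BZL (models (modular_eq :: ortho_eqs)).
Proof.
apply: classext => A.
  case=> ol hm hk; split; first exact: ortho_BZL.
  move=> v /=; do ?split=> //; last exact: (ol_compl ol).
  by apply: hm; exact: (meet_ler (bi_lat (ol_bi ol))).
case=> bz h; have {}h a b c := h (env a b c).
split; last by move=> a; have := h a a a; case=> _ [] _ [].
  by split; [exact: pk_bi (bz_pk bz)|move=> a; have := h a a a; case=> _ []].
by move=> a b c ac; have := h a b c; rewrite /= /env /= ac; case.
Qed.

Lemma MOL_variety : is_variety MOL.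
Proof. by rewrite MOL_models; apply: capc_variety BZL_variety (models_variety _). Qed.

Lemma BA_models : BA = capc MOL (models [:: distributive_eq]).
Proof.
apply: classext => A.
  by move=> bA; split; [exact: BA_MOL|case: bA => _ hd _ v; split=> //; exact: hd].
case=> -[ol _ hk] h; split=> // a b c.
by case: (h (env a b c)).
Qed.

Lemma BA_variety : is_variety BA.
Proof. by rewrite BA_models; apply: capc_variety MOL_variety (models_variety _). Qed.

(** If [a <= b] and [a' /\ b = 0], then [a \/ a' = 1],
    so that [b = (b /\ a') \/ (b /\ a) = a]. This makes [DIST] equational. *)
Lemma distributive_paraorthomodular (L : bzalg) : bi_lattice L -> distributive L -> paraorthomodular L.
Proof.
move=> bi hd a b ab ab0; have bl := bi_lat bi.
have aa : a ⊔ kl a = top.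
  rewrite -(bi_invol bi (a ⊔ kl a)) (kl_join bi) (bi_invol bi).
  suff -> : kl a ⊓ a = bot by rewrite (kl_bot bi).
  apply: (le_bot bl); rewrite -ab0; apply: (le_meet bl); first exact: (meet_lel bl).
  exact: (le_trans bl (meet_ler bl _ _)).
rewrite -[b](bl_top bl) -aa hd (bl_meetC bl b (kl a)) ab0 (bl_meetC bl b) ab.
by rewrite (join_botr bl).
Qed.

Lemma DIST_models : DIST = capc BZL (models [:: distributive_eq; star_eq]).
Proof.
apply: classext => A.
  by case=> -[bz hs _] hd; split=> // v; split; [exact: hd|split=> //; exact: hs].
case=> bz h; have hd : distributive A.
  by move=> a b c; case: (h (env a b c)).
split=> //; split=> //; last exact: distributive_paraorthomodular (pk_bi (bz_pk bz)) hd.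
by move=> a; case: (h (env a a a)) => _ [].
Qed.

Lemma DIST_variety : is_variety DIST.
Proof. by rewrite DIST_models; apply: capc_variety BZL_variety (models_variety _). Qed.

Lemma DIST_BZL : subc DIST BZL.
Proof. by move=> A [[]]. Qed.

Lemma AOL_BZL : subc AOL BZL.
Proof. by move=> A [[]]. Qed.

Lemma BA_DIST : subc BA DIST.
Proof.
move=> A bA; have bz := OML_BZL (MOL_OML (BA_MOL bA)).
case: (bA) => ol hd hk; rewrite DIST_models; split=> // v; split; first exact: hd.
split=> //=; rewrite !hk (kl_meet (ol_bi ol)) //.
Qed.

(** A trivial algebra satisfies all identities. *)
Lemma TRIV_sub V : is_variety V -> subc TRIV V.
Proof.
move=> vV A tA; apply: birkhoff => // s t _; exact: tA.
Qed.

(** * Boolean identities *)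

Lemma chain_hom n (A : bzalg) (f : D n -> A) : bounded_lattice A ->
  (forall i j : D n, (i <= j)%N -> f i ⊑ f j) ->
  (forall i, f (kl i) = kl (f i)) ->
  br (bot : A) = top -> (forall i : D n, i <> bot -> br (f i) = bot) ->
  f bot = bot -> f top = top -> is_hom f.
Proof.
move=> bl mono fkl b0 bi f0 f1; split=> // [i j|i j|i] /=.
- case: (leqP i j) => [ij|/ltnW ji].
    by rewrite Order.POrderTheory.min_l ?mono.
  by rewrite Order.POrderTheory.min_r // (bl_meetC bl) mono.
- case: (leqP i j) => [ij|/ltnW ji].
    by rewrite Order.POrderTheory.max_r //; symmetry; apply/(le_joinE bl)/mono.
  by rewrite Order.POrderTheory.max_l // (bl_joinC bl); symmetry; apply/(le_joinE bl)/mono.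
- rewrite /trivial_br; case: asboolP => [->|ni].
    by rewrite [LHS]f1 [f _]f0.
  by rewrite [LHS]f0 bi.
Qed.

Definition two (A : bzalg) (i : D 2) : A := if (i : nat) == 0 then bot else top.

Lemma two_hom A : BZL A -> is_hom (@two A).
Proof.
move=> bz; have bi := pk_bi (bz_pk bz); have bl := bi_lat bi.
apply: chain_hom => //; rewrite /two.
- move=> [[|[|//]] ?] [[|[|//]] ?] //= _; rewrite ?(meet_id bl) //.
  exact: (bl_bot bl).
- by move=> [[|[|//]] ?]; rewrite /= ?subSS ?(kl_bot bi) ?(kl_top bi).
- exact: br_bot.
- move=> [[|[|//]] ?] //= ne; last exact: br_top.
  by case: ne; apply: val_inj.
Qed.

Lemma nontrivial_D2 V : subvariety V BZL -> nontrivial V -> V (D 2).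
Proof.
case=> vV VB [A [VA ntA]]; have bz := VB _ VA.
apply: (var_S vV (two_hom bz)) VA => i j.
have bl := bi_lat (pk_bi (bz_pk bz)).
have n01 : bot <> top :> A.
  move=> e; apply: ntA => a b.
  by rewrite -[a](bl_top bl) -[b](bl_top bl) -e !(meet_botr bl).
rewrite /two; case: i j => [[|[|//]] ?] [[|[|//]] ?] //= e; try exact: val_inj.
by case: n01.
Qed.

Fixpoint vars (X : Type) (t : term X) : seq X :=
  match t with
  | TVar x => [:: x]
  | TMeet s t | TJoin s t => vars s ++ vars t
  | TKl s | TBr s => vars s
  | TBot | TTop => [::]
  end.

Lemma ev_ext (X : Type) (A : bzalg) (v w : X -> A) t :
  (forall x, List.In x (vars t) -> v x = w x) -> ev v t = ev w t.
Proof.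
elim: t => //= [x|s IHs t IHt|s IHs t IHt|s IHs|s IHs] h.
- by apply: h; left.
- by rewrite IHs ?IHt // => x hx; apply: h; apply: List.in_or_app; [right|left].
- by rewrite IHs ?IHt // => x hx; apply: h; apply: List.in_or_app; [right|left].
- by rewrite IHs.
- by rewrite IHs.
Qed.

Definition two_valued (X : Type) (A : bzalg) (v : X -> A) (l : seq X) :=
  forall x, List.In x l -> v x = bot \/ v x = top.

Lemma two_valued_ev (X : Type) (A : bzalg) (v : X -> A) (s t : term X) :
  BZL A -> sat (eq (D 2)) s t -> two_valued v (vars s ++ vars t) ->
  ev v s = ev v t.
Proof.
move=> bz st tv.
pose w x : D 2 := if `[< v x = top >] then ord_max else ord0.
have vw x : List.In x (vars s ++ vars t) -> v x = two A (w x).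
  move=> /tv; rewrite /w /two; by case: asboolP => [-> //|nt] [->|/nt].
rewrite (@ev_ext _ _ v (fun x => two A (w x)) s); last first.
  by move=> x hx; apply: vw; apply: List.in_or_app; left.
rewrite (@ev_ext _ _ v (fun x => two A (w x)) t); last first.
  by move=> x hx; apply: vw; apply: List.in_or_app; right.
by rewrite -!(hom_ev _ _ (two_hom bz)) (st _ w erefl).
Qed.

Section Boole.
Variables (B : bzalg) (bB : BA B) (X : Type).
Let ol : ortholattice B. Proof. by case: bB. Qed.
Let hd : distributive B. Proof. by case: bB. Qed.
Let hk : br_is_kl B. Proof. by case: bB. Qed.
Let bi := ol_bi ol.
Let bl := bi_lat bi.
Implicit Types (a b z : B) (v w : X -> B).

(** Makes [a /\ z = b /\ z] a congruence. *)
Lemma kl_meet_local a z : kl a ⊓ z = kl (a ⊓ z) ⊓ z.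
Proof.
rewrite (kl_meet bi) ![_ ⊓ z](bl_meetC bl) hd ortho_meet_kl //.
by rewrite (join_botr bl).
Qed.

Lemma ev_cong z v w t : (forall x, v x ⊓ z = w x ⊓ z) -> ev v t ⊓ z = ev w t ⊓ z.
Proof.
move=> vw.
have mm (a b : B) : a ⊓ b ⊓ z = (a ⊓ z) ⊓ (b ⊓ z).
  by rewrite (bl_meetC bl b z) (bl_meetA bl) -(bl_meetA bl a z z) (meet_id bl)
    -(bl_meetA bl a z b) (bl_meetC bl z b) (bl_meetA bl).
have jj (a b : B) : (a ⊔ b) ⊓ z = (a ⊓ z) ⊔ (b ⊓ z).
  by rewrite ![_ ⊓ z](bl_meetC bl) hd.
elim: t => //= [s IHs t IHt|s IHs t IHt|s IHs|s IHs].
- by rewrite mm IHs IHt -mm.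
- by rewrite jj IHs IHt -jj.
- by rewrite kl_meet_local IHs -kl_meet_local.
- by rewrite !hk kl_meet_local IHs -kl_meet_local.
Qed.

Lemma split_eq z a b : a ⊓ z = b ⊓ z -> a ⊓ kl z = b ⊓ kl z -> a = b.
Proof.
move=> h1 h2; rewrite -[a](bl_top bl) -[b](bl_top bl) -(ol_compl ol z) !hd.
by rewrite h1 h2.
Qed.

(** Shannon expansion, one variable at a time: below [v x] the value
    of [v x] may be replaced by 1 and below its complement by 0, so it is enough
    to know the identity for valuations in {0, 1}. *)
Lemma BA_two_identity (s t : term X) v : sat (eq (D 2)) s t -> ev v s = ev v t.
Proof.
move=> st; have bz : BZL B := OML_BZL (MOL_OML (BA_MOL bB)).
suff gen (l : seq X) : forall v,
    (forall x, ~ List.In x l -> v x = bot \/ v x = top) -> ev v s = ev v t.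
  (* Variables not in the terms may be set to 0. *)
  pose w x := if `[< List.In x (vars s ++ vars t) >] then v x else bot.
  have wv x : List.In x (vars s ++ vars t) -> v x = w x.
    by move=> hx; rewrite /w asboolT.
  rewrite (@ev_ext _ _ v w s); last first.
    by move=> x hx; apply: wv; apply: List.in_or_app; left.
  rewrite (@ev_ext _ _ v w t); last first.
    by move=> x hx; apply: wv; apply: List.in_or_app; right.
  apply: (gen (vars s ++ vars t)) => x hx; left.
  by rewrite /w asboolF.
elim: l => [u hu|x l IH u hu].
  by apply: two_valued_ev => // x _; apply: hu.
pose upd b y := if `[< y = x >] then b else u y.
have updE b : b = bot \/ b = top -> ev (upd b) s = ev (upd b) t.
  move=> hb; apply: IH => y nyl; rewrite /upd; case: asboolP => // nyx.
  by apply: hu => /= -[xy|//]; apply: nyx.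
apply: (@split_eq (u x)).
  have ut r : ev u r ⊓ u x = ev (upd top) r ⊓ u x.
    apply: ev_cong => y; rewrite /upd; case: asboolP => // ->.
    by rewrite (meet_id bl) (meet_topl bl).
  by rewrite !ut updE //; right.
have ub r : ev u r ⊓ kl (u x) = ev (upd bot) r ⊓ kl (u x).
  apply: ev_cong => y; rewrite /upd; case: asboolP => // ->.
  by rewrite (meet_botl bl) ortho_meet_kl.
by rewrite !ub updE //; left.
Qed.

End Boole.

Lemma BA_sub V : is_variety V -> V (D 2) -> subc BA V.
Proof.
move=> vV VD A bA; apply: birkhoff => // s t st; apply: BA_two_identity => //.
by move=> B v eB; apply: st; rewrite -eB.
Qed.

(** * Recovering the components of a join *)

Lemma AOL_sharp (A : bzalg) (a : A) : AOL A -> a ⊓ kl a = bot -> a = bot \/ a = top.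
Proof.
case=> -[bz hs _] b0 bn aa; have bi := pk_bi (bz_pk bz); have bl := bi_lat bi.
have [|na] := pselect (a = bot); first by left.
have [nka|nka] := pselect (kl a = bot).
  by right; rewrite -(bi_invol bi a) nka (kl_bot bi).
have := hs a; rewrite aa b0 (bn _ na) (bn _ nka) (join_botl bl) => e.
by left; rewrite -[a](bl_top bl) e (meet_botr bl).
Qed.

Fixpoint sharp_test (X : Type) (l : seq X) : term X :=
  if l is x :: l' then
    TMeet (TBr (TMeet (TVar x) (TKl (TVar x)))) (sharp_test l')
  else TTop.

Lemma sharp_test_OML (X : Type) (A : bzalg) (v : X -> A) l :
  OML A -> ev v (sharp_test l) = top.
Proof.
move=> oA; have bz := OML_BZL oA; have bl := bi_lat (pk_bi (bz_pk bz)).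
case: oA => ol _ hk.
elim: l => //= x l ->.
by rewrite ortho_meet_kl // br_bot // (bl_top bl).
Qed.

(** In an antiortholattice [(x /\ x')~] is 1 if [x] is 0 or 1, and 0
    otherwise. *)
Lemma sharp_test_AOL (X : Type) (A : bzalg) (v : X -> A) l : AOL A ->
  ev v (sharp_test l) = bot \/ ev v (sharp_test l) = top /\ two_valued v l.
Proof.
move=> aA; have bz := AOL_BZL aA; have bl := bi_lat (pk_bi (bz_pk bz)).
elim: l => [|x l IH] /=; first by right; split.
have [xx|xx] := pselect (v x ⊓ kl (v x) = bot); last first.
  by left; case: aA => _ _ ->; rewrite ?(meet_botl bl).
rewrite xx br_bot // (meet_topl bl); case: IH => [->|[-> tv]]; first by left.
right; split=> // y /= [<-|]; last exact: tv.
exact: AOL_sharp.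
Qed.

Definition gated (X : Type) (l : seq X) (t : term X) : term X :=
  TMeet t (TKl (sharp_test l)).

(** The added factor vanishes in orthomodular lattices, so an identity
    of [V] becomes an identity of the join. *)
Lemma gated_sat V W (X : Type) (l : seq X) (s t : term X) : subc V BZL -> subc W OML ->
  sat V s t -> sat (vjoin V W) (gated l s) (gated l t).
Proof.
move=> VB WO st; apply: vjoin_sat => //.
- by move=> A /WO; exact: OML_BZL.
- by move=> A v VA /=; rewrite (st A v VA).
- move=> A v /WO oA /=; have bi := pk_bi (bz_pk (OML_BZL oA)).
  by rewrite sharp_test_OML // (kl_top bi) !(meet_botr (bi_lat bi)).
Qed.

(** As soon as one variable takes a nonsharp value, the factor
    of [gated] is 1 in an antiortholattice. *)
Lemma AOL_unsharp_identity V W (X : Type) (s t : term X) (A : bzalg) (v : X -> A) x :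
  subc V BZL -> subc W OML -> sat V s t -> AOL A -> vjoin V W A ->
  v x ⊓ kl (v x) <> bot -> ev v s = ev v t.
Proof.
move=> VB WO st aA vA xx; have := gated_sat [:: x] VB WO st v vA => /=.
have bi := pk_bi (bz_pk (AOL_BZL aA)).
rewrite -/(sharp_test [:: x]).
have -> : br (v x ⊓ kl (v x)) = bot by case: aA => _ _; apply.
by rewrite (meet_botl (bi_lat bi)) (kl_bot bi) !(bl_top (bi_lat bi)).
Qed.

Lemma VAOL_BZL : subc (VBZL AOL) BZL.
Proof. by apply: VBZL_BZL; exact: AOL_BZL. Qed.

Lemma subvariety_trans V K1 K2 : subvariety V K1 -> subc K1 K2 -> subvariety V K2.
Proof. by case=> vV h1 h2; split=> // A /h1/h2. Qed.

(** With [e] the sharpness test of all variables, [s /\ e' = t /\ e']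
    holds in the join, and [s /\ e = t /\ e] holds in every antiortholattice, since
    [e] is nonzero only for valuations in {0, 1}, where [s = t] because [V]
    contains the two-element algebra. Finally [r = (r /\ e) \/ (r /\ e')] holds in
    [VBZL AOL], which glues the two equations. *)
Lemma VAOL_part_of_join V W A : subvariety V (VBZL AOL) -> nontrivial V -> subc W OML ->
  VBZL AOL A -> vjoin V W A -> V A.
Proof.
move=> hV ntV WO aA vA; have VB : subc V BZL by move=> B /(proj2 hV)/VAOL_BZL.
have VD : V (D 2) by apply: nontrivial_D2 => //; split=> //; case: hV.
apply: birkhoff (proj1 hV) _ => s t st.
pose l := vars s ++ vars t; pose e := sharp_test l.
have split_sat r : sat (VBZL AOL) (TJoin (TMeet r e) (TMeet r (TKl e))) r.
  apply: VBZL_sat => [|B v bB]; first exact: AOL_BZL.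
  have bi := pk_bi (bz_pk (AOL_BZL bB)); have bl := bi_lat bi.
  rewrite /= /e; case: (sharp_test_AOL v l bB) => [->|[-> _]].
    by rewrite (kl_bot bi) (meet_botr bl) (join_botl bl) (bl_top bl).
  by rewrite (kl_top bi) (meet_botr bl) (join_botr bl) (bl_top bl).
have sharp_sat : sat (VBZL AOL) (TMeet s e) (TMeet t e).
  apply: VBZL_sat => [|B v bB]; first exact: AOL_BZL.
  have bz := AOL_BZL bB; have bl := bi_lat (pk_bi (bz_pk bz)).
  rewrite /= /e; case: (sharp_test_AOL v l bB) => [->|[-> tv]].
    by rewrite !(meet_botr bl).
  by rewrite (two_valued_ev bz _ tv) // => C w eC; apply: st; rewrite -eC.
have := gated_sat l VB WO st id vA => /= gst.
rewrite -(split_sat s A id aA) -(split_sat t A id aA) /= gst.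
by have /= -> := sharp_sat A id aA.
Qed.

Fixpoint tbr (X : Type) (t : term X) : term X :=
  match t with
  | TVar x => TBr (TVar x)
  | TMeet s t => TMeet (tbr s) (tbr t)
  | TJoin s t => TJoin (tbr s) (tbr t)
  | TKl s => TKl (tbr s)
  | TBr s => TBr (tbr s)
  | TBot => TBot
  | TTop => TTop
  end.

Lemma ev_tbr (X : Type) (A : bzalg) (v : X -> A) t :
  ev v (tbr t) = ev (fun x => br (v x)) t.
Proof. by elim: t => //= [s -> t ->|s -> t ->|s ->|s ->]. Qed.

(** Brouwer complements of members of [W] satisfy all Boolean
    identities. *)
Definition brouwer_boolean (W : bzclass) :=
  subc W BZL /\ forall (X : Type) (s t : term X),
    sat (eq (D 2)) s t -> sat W (tbr s) (tbr t).

Lemma VAOL_brouwer_boolean : brouwer_boolean (VBZL AOL).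
Proof.
split=> [|X s t st]; first exact: VAOL_BZL.
apply: VBZL_sat => [|A v aA]; first exact: AOL_BZL.
rewrite !ev_tbr; apply: two_valued_ev => //; first exact: AOL_BZL.
move=> x _; case: (aA) => _ b0 bn; have [->|/bn ->] := pselect (v x = bot).
  by right.
by left.
Qed.

(** By the star condition applied to [b~], whose meet with [b~'= b~~] is
    0, a Brouwer complement is complemented by its Kleene complement. *)
Lemma brouwer_BA A (bz : BZL A) : DIST A -> BA (subalg (brouwer_closed bz)).
Proof.
move=> dA; set S := subalg _.
have dS : DIST S by apply: subalg_variety => //; exact: DIST_variety.
have [bi bl] : bi_lattice S /\ bounded_lattice S.
  by have bi := pk_bi (bz_pk (DIST_BZL dS)); split=> //; exact: bi_lat.
split.
- split=> // -[a [b ab]]; apply: subalg_inj => /=; rewrite {}ab.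
  case: dA => -[_ hs _] _; have := hs (br b).
  rewrite -(bz_brkl bz) (bz_disj bz) (br_bot bz) (bz_brkl bz (br b)).
  rewrite (bz_brkl bz b) (bi_invol (pk_bi (bz_pk bz))).
  by rewrite (bl_joinC (bi_lat (pk_bi (bz_pk bz)))).
- by case: dS.
- by move=> [a [b ab]]; apply: subalg_inj => /=; rewrite ab; exact: bz_brkl.
Qed.

Lemma DIST_brouwer_boolean : brouwer_boolean DIST.
Proof.
split=> [|X s t st A v dA]; first exact: DIST_BZL.
have bz := DIST_BZL dA.
pose w x : subalg (brouwer_closed bz) := exist _ (br (v x)) (ex_intro _ (v x) erefl).
have sh := @subalg_hom _ _ (brouwer_closed bz).
rewrite !ev_tbr -[LHS](hom_ev w s sh) -[RHS](hom_ev w t sh).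
by congr sval; exact: (BA_two_identity (brouwer_BA bz dA) _ st).
Qed.

(** If [s = t] holds in [U], it holds in the two-element algebra, so
    with [x~] substituted for [x] it holds in both [U] and [W]. In the
    orthomodular lattice [A] valuate each [x] by [x'], whose Brouwer complement
    is [x]. *)
Lemma OML_part_of_join U W A : subvariety U OML -> nontrivial U -> brouwer_boolean W ->
  OML A -> vjoin U W A -> U A.
Proof.
move=> hU ntU [WB hW] oA vA; have UB : subc U BZL by move=> B /(proj2 hU)/OML_BZL.
have UD : U (D 2) by apply: nontrivial_D2 => //; split=> //; case: hU.
apply: birkhoff (proj1 hU) _ => s t st.
have sU : sat U (tbr s) (tbr t) by move=> B v UB'; rewrite !ev_tbr; exact: st.
have sW : sat W (tbr s) (tbr t) by apply: hW => B v eB; apply: st; rewrite -eB.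
have := vjoin_sat UB WB sU sW (@kl A) vA; rewrite !ev_tbr.
suff -> : (fun x : A => br (kl x)) = id by [].
by case: oA => -[bi _] _ hk; apply: funext => x; rewrite hk (bi_invol bi).
Qed.

(** * Antiortholattices and modular ortholattices *)

(** The star condition and paraorthomodularity both reduce to the
    absence of sharp elements other than 0 and 1: in the latter, [a' /\ b = 0] with
    [a <= b] forces [a /\ a' = 0]. *)
Lemma trivial_br_AOL (L : bzalg) : pseudo_kleene L ->
  (forall a : L, br a = trivial_br bot top a) ->
  (forall a : L, a ⊓ kl a = bot -> a = bot \/ a = top) -> AOL L.
Proof.
move=> pk brE sharp; have bi := pk_bi pk; have bl := bi_lat bi.
have b0 : br (bot : L) = top by rewrite brE /trivial_br asboolT.
have bn (a : L) : a <> bot -> br a = bot by move=> na; rewrite brE /trivial_br asboolF.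
split=> //; split.
- split=> // [a b ab|a|a|a].
  + have [b0'|/bn ->] := pselect (b = bot); last exact: (bl_bot bl).
    by rewrite -ab b0' (meet_botr bl) (meet_id bl).
  + have [->|/bn ->] := pselect (a = bot); last exact: (meet_botr bl).
    exact: (meet_botl bl).
  + have [->|/bn ->] := pselect (a = bot); first exact: (meet_botl bl).
    by rewrite b0 (bl_top bl).
  + have [->|/bn ->] := pselect (a = bot); last by rewrite b0 (kl_bot bi).
    rewrite b0 (kl_top bi); have [e|/bn //] := pselect (top = bot :> L).
    by rewrite {1}e b0.
- move=> a; have [aa|aa] := pselect (a ⊓ kl a = bot); last first.
    rewrite !bn ?(join_botl bl) // => [ka|ka]; apply: aa.
      by rewrite ka (meet_botr bl).
    by rewrite ka (meet_botl bl).
  rewrite aa b0; case: (sharp a aa) => ->; first by rewrite b0 (join_topl bl).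
  by rewrite (kl_top bi) b0 (join_topr bl).
- move=> a b ab ab0.
  have aa : a ⊓ kl a = bot.
    apply: (le_bot bl); rewrite -ab0; apply: (le_meet bl); first exact: (meet_ler bl).
    exact: (le_trans bl (meet_lel bl _ _)).
  case: (sharp a aa) => a0; move: ab ab0; rewrite a0.
    by rewrite (kl_bot bi) (meet_topl bl).
  by rewrite (meet_topl bl).
Qed.

Lemma trivial_br_hom (A B : bzalg) (f : A -> B) :
  (forall a : A, br a = trivial_br bot top a) ->
  (forall b : B, br b = trivial_br bot top b) ->
  (forall a, f a = bot -> a = bot) ->
  (forall a b : A, f (a ⊓ b) = f a ⊓ f b) ->
  (forall a b : A, f (a ⊔ b) = f a ⊔ f b) ->
  (forall a : A, f (kl a) = kl (f a)) ->
  f bot = bot -> f top = top -> is_hom f.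
Proof.
move=> bA bB f0 fm fj fk fb ft; split=> // a; rewrite bA bB /trivial_br.
case: asboolP => [->|na]; first by rewrite fb asboolT.
by rewrite asboolF // => /f0.
Qed.

Section MO.
Variable I : eqType.

Ltac mo_cases := repeat (match goal with
  | |- context [@eq_op _ ?a ?b] =>
     case: (@eqP _ a b) => [?|?]; try subst; rewrite ?eqxx /=
  end; try done; try congruence).

Lemma MO_lattice : bounded_lattice (MO I).
Proof.
split=> /=.
- by move=> [||i x] [||j y] //=; rewrite (eq_sym j) (eq_sym y); mo_cases.
- by move=> [||i x] [||j y] //=; rewrite (eq_sym j) (eq_sym y); mo_cases.
- by move=> [||i x] [||j y] [||k z] //=; mo_cases.
- by move=> [||i x] [||j y] [||k z] //=; mo_cases.
- by move=> [||i x] [||j y] //=; mo_cases.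
- by move=> [||i x] [||j y] //=; mo_cases.
- by case.
- by case.
Qed.

Lemma MO_MOL : MOL (MO I).
Proof.
split=> //.
  split.
    split; first exact: MO_lattice.
      by move=> [||i x] [||j y] //=; mo_cases.
    by move=> [||i x] //=; rewrite negbK.
  by move=> [||i x] //=; rewrite eqxx; case: x.
by move=> [||i x] [||j y] [||k z] //=; mo_cases.
Qed.
End MO.

Definition MO_map (I J : eqType) (f : I -> J) (x : MO I) : MO J :=
  match x with
  | mo_bot => mo_bot
  | mo_top => mo_top
  | mo_elt i b => mo_elt (f i) b
  end.

Lemma MO_map_hom (I J : eqType) (f : I -> J) : injective f -> is_hom (MO_map f).
Proof.
move=> fi; split=> //; [| |by case|by case];
  by move=> [||i x] [||j y] //=; rewrite (inj_eq fi); case: ifP.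
Qed.

Lemma MO_map_inj (I J : eqType) (f : I -> J) : injective f -> injective (MO_map f).
Proof. by move=> fi [||i x] [||j y] //= [/fi -> ->]. Qed.

Section Ext.
Variables (K : bzalg).

Lemma ext_br (a : ext K) : br a = trivial_br bot top a.
Proof. by []. Qed.

Hypothesis bl : bounded_lattice K.

Lemma ext_lattice : bounded_lattice (ext K).
Proof.
case: bl => mC jC mA jA mK jK _ _.
split=> /=; do ?[by case].
- by move=> [|a|] [|b|] //=; rewrite mC.
- by move=> [|a|] [|b|] //=; rewrite jC.
- by move=> [|a|] [|b|] [|c|] //=; rewrite mA.
- by move=> [|a|] [|b|] [|c|] //=; rewrite jA.
- by move=> [|a|] [|b|] //=; rewrite ?mK // (meet_id bl).
- move=> [|a|] [|b|] //=; rewrite ?jK //; congr ext_mid.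
  by apply/(le_joinE bl)/(meet_id bl).
Qed.

Lemma ext_modular : modular K -> modular (ext K).
Proof.
move=> hm [|a|] [|b|] [|c|] //= [ac].
- by rewrite (hm _ _ _ ac).
- by rewrite (proj1 (le_joinE bl _ _) ac).
Qed.
End Ext.

Lemma ext_AOL (K : bzalg) : pseudo_kleene K -> AOL (ext K).
Proof.
move=> [bi hk]; have bl := bi_lat bi; apply: trivial_br_AOL.
- split.
    split; first exact: ext_lattice.
      by move=> [|a|] [|b|] //= [ab]; rewrite (bi_anti bi).
    by move=> [|a|] //=; rewrite (bi_invol bi).
  by move=> [|a|] [|b|] //=; rewrite hk.
- exact: ext_br.
- by move=> [|a|] //; [left|right].
Qed.

Lemma ext_SDM (K : bzalg) : pseudo_kleene K -> SDM (ext K).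
Proof.
move=> pk; case: (ext_AOL pk) => pbz b0 bn; split=> // a b.
have bl := bi_lat (pk_bi (bz_pk (pbz_bz pbz))).
have [->|na] := pselect (a = bot).
  by rewrite (meet_botl bl) b0 (join_topl bl).
have [->|nb] := pselect (b = bot).
  by rewrite (meet_botr bl) b0 (join_topr bl).
rewrite !bn ?(join_botl bl) //.
by case: a b na nb => [|a|] [|b|] //=.
Qed.

Lemma ext_embed (K L : bzalg) (f : K -> L) (V : bzclass) : is_variety V ->
  is_hom f -> injective f -> V (ext L) -> V (ext K).
Proof.
move=> vV [fm fj fk _ _ _] fi.
pose g (x : ext K) : ext L := match x with
  | ext_bot => ext_bot | ext_top => ext_top | ext_mid a => ext_mid (f a) end.
apply: (var_S (f := g) vV); last by move=> [|a|] [|b|] //= [/fi ->].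
apply: trivial_br_hom => //; first by case.
- by move=> [|a|] [|b|] //=; rewrite fm.
- by move=> [|a|] [|b|] //=; rewrite fj.
- by move=> [|a|] //=; rewrite fk.
Qed.

(** * Ordinal sums of powers of the two-element chain *)

Section PowSum.
Variable I : Type.
Implicit Types p q : pow_sum I.

Lemma glued_inj p q : (forall i, (sval p).1 i = (sval q).1 i) ->
  (forall i, (sval p).2 i = (sval q).2 i) -> p = q.
Proof.
case: p q => [[x y] hp] [[z t] hq] /= xz yt; apply: eq_exist => /=.
by congr pair; apply: funext.
Qed.

Lemma glued_cover p i : (sval p).1 i || (sval p).2 i.
Proof. by case: p => [[x y] /= [] ->]; rewrite ?orbT. Qed.

Ltac glued_cases := apply: glued_inj => ? /=;
  rewrite /pmeet /pjoin /p0 /p1 /=;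
  repeat match goal with |- context [fst (sval ?a) ?k] => case: (fst (sval a) k) end;
  repeat match goal with |- context [snd (sval ?a) ?k] => case: (snd (sval a) k) end;
  by [].

Lemma pow_sum_lattice : bounded_lattice (pow_sum I).
Proof. by split=> *; glued_cases. Qed.

Lemma pow_sum_distributive : distributive (pow_sum I).
Proof. by move=> a b c; glued_cases. Qed.

Lemma pow_sum_AOL : AOL (pow_sum I).
Proof.
apply: trivial_br_AOL => //.
- split.
    split; first exact: pow_sum_lattice; last by move=> a; glued_cases.
    move=> a b ab; apply: glued_inj => i /=.
      have := congr1 (fun p : pow_sum I => (sval p).2 i) ab; rewrite /= /pmeet /pjoin.
      by case: ((sval a).2 i); case: ((sval b).2 i).
    have := congr1 (fun p : pow_sum I => (sval p).1 i) ab; rewrite /= /pmeet /pjoin.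
    by case: ((sval a).1 i); case: ((sval b).1 i).
  move=> a b; apply: glued_inj => i /=; rewrite /pmeet /pjoin;
    move: (glued_cover a i) (glued_cover b i);
    case: ((sval a).1 i); case: ((sval a).2 i);
    by case: ((sval b).1 i); case: ((sval b).2 i).
- move=> p pp; have pi i : (sval p).1 i && (sval p).2 i = false.
    exact: (congr1 (fun p : pow_sum I => (sval p).1 i) pp).
  case: (svalP p) => p1E; [right|left]; apply: glued_inj => i;
    have := pi i; rewrite p1E //= /p1 /p0 ?andbT; by case: ((sval p).2 i).
Qed.

Lemma pow_sum_DIST : DIST (pow_sum I).
Proof. by case: pow_sum_AOL => h _ _; split=> //; exact: pow_sum_distributive. Qed.

End PowSum.

Section PowSumMap.
Variables (I J : Type) (f : I -> J) (fs : forall j, exists i, f i = j).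

Fact pow_sum_map_subproof (p : pow_sum J) :
  ((sval p).1 \o f, (sval p).2 \o f).1 = @p1 I \/
  ((sval p).1 \o f, (sval p).2 \o f).2 = @p1 I.
Proof. by case: (svalP p) => /= ->; [left|right]. Qed.

Definition pow_sum_map (p : pow_sum J) : pow_sum I :=
  exist _ _ (pow_sum_map_subproof p).

Lemma pow_sum_map_inj : injective pow_sum_map.
Proof.
move=> p q pq; apply: glued_inj => j; have [i <-] := fs j.
  exact: (congr1 (fun p : pow_sum I => (sval p).1 i) pq).
exact: (congr1 (fun p : pow_sum I => (sval p).2 i) pq).
Qed.

Lemma pow_sum_map_hom : is_hom pow_sum_map.
Proof.
have f0 : pow_sum_map bot = bot by apply: glued_inj.
apply: trivial_br_hom => //; try by move=> *; apply: glued_inj.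
by move=> a; rewrite -f0 => /pow_sum_map_inj.
Qed.

Lemma pow_sum_embed V : is_variety V -> V (pow_sum I) -> V (pow_sum J).
Proof. by move=> vV; apply: (var_S vV pow_sum_map_hom); exact: pow_sum_map_inj. Qed.

End PowSumMap.

Section PowSum2.
Variable J : Type.

(** Extending by false at the new coordinate separates the top of the
    lower copy of [D_2^J] from the glued point of [pow_sum (option J)]. *)
Definition lift_false (x : J -> bool) (o : option J) : bool :=
  if o is Some j then x j else false.

Definition pow_sum2_map (p : pow_sum2 J) : pow_sum (option J) :=
  match p with
  | low x => exist _ (lift_false x, @p1 _) (or_intror erefl)
  | up x => exist _ (@p1 _, lift_false x) (or_introl erefl)
  end.

Lemma pow_sum2_map_inj : injective pow_sum2_map.
Proof.
move=> [x|x] [y|y] xy.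
- congr low; apply: funext => j.
  exact: (congr1 (fun p : pow_sum (option J) => (sval p).1 (Some j)) xy).
- by have := congr1 (fun p : pow_sum (option J) => (sval p).1 None) xy.
- by have := congr1 (fun p : pow_sum (option J) => (sval p).1 None) xy.
- congr up; apply: funext => j.
  exact: (congr1 (fun p : pow_sum (option J) => (sval p).2 (Some j)) xy).
Qed.

Lemma pow_sum2_map_hom : is_hom pow_sum2_map.
Proof.
have f0 : pow_sum2_map bot = bot by apply: glued_inj => // -[].
apply: trivial_br_hom => //.
- by move=> a; rewrite -f0 => /pow_sum2_map_inj.
- by move=> [x|x] [y|y]; apply: glued_inj => -[i|] //=; rewrite /pmeet /pjoin /p1 /= ?andbT ?orbT.
- by move=> [x|x] [y|y]; apply: glued_inj => -[i|] //=; rewrite /pmeet /pjoin /p1 /= ?andbT ?orbT.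
- by move=> [x|x]; apply: glued_inj.
- by apply: glued_inj => // -[].
Qed.

Lemma pow_sum2_embed V : is_variety V -> V (pow_sum (option J)) -> V (pow_sum2 J).
Proof. by move=> vV; apply: (var_S vV pow_sum2_map_hom); exact: pow_sum2_map_inj. Qed.

(** Collapses the middle pair [low p1], [up p1]. *)
Definition glue_middle (p : pow_sum2 J) : pow_sum J :=
  match p with
  | low x => exist _ (x, @p1 _) (or_intror erefl)
  | up x => exist _ (@p1 _, x) (or_introl erefl)
  end.

Lemma glue_middle_hom : J -> is_hom glue_middle.
Proof.
move=> j0; apply: trivial_br_hom => //.
- move=> [x|x] xb.
    congr low; apply: funext => j.
    exact: (congr1 (fun p : pow_sum J => (sval p).1 j) xb).
  by have := congr1 (fun p : pow_sum J => (sval p).1 j0) xb.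
- by move=> [x|x] [y|y]; apply: glued_inj => i //=; rewrite /pmeet /pjoin /p1 /= ?andbT ?orbT.
- by move=> [x|x] [y|y]; apply: glued_inj => i //=; rewrite /pmeet /pjoin /p1 /= ?andbT ?orbT.
- by move=> [x|x]; apply: glued_inj.
Qed.

Lemma pow_sum_quotient V : J -> is_variety V -> V (pow_sum2 J) -> V (pow_sum J).
Proof.
move=> j0 vV; apply: (var_H vV (glue_middle_hom j0)) => p.
case: (svalP p) => e; [exists (up (sval p).2)|exists (low (sval p).1)];
  by apply: glued_inj => i //=; rewrite e.
Qed.

End PowSum2.

(** * Separating identities *)

Fixpoint tmeet (X T : Type) (F : T -> term X) (s : seq T) : term X :=
  if s is x :: s' then TMeet (F x) (tmeet F s') else TTop.

Section Tmeet.
Variables (X : Type) (T : eqType) (F : T -> term X).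
Variables (A : bzalg) (bl : bounded_lattice A) (v : X -> A).

Lemma tmeet_le s x : x \in s -> ev v (tmeet F s) ⊑ ev v (F x).
Proof.
elim: s => //= y s IH; rewrite inE => /orP[/eqP->|/IH h]; first exact: (meet_lel bl).
exact: (le_trans bl (meet_ler bl _ _)).
Qed.

Lemma le_tmeet z s : (forall x, x \in s -> z ⊑ ev v (F x)) -> z ⊑ ev v (tmeet F s).
Proof.
elim: s => [_|y s IH h] /=; first exact: (bl_top bl).
apply: (le_meet bl); first by apply: h; rewrite inE eqxx.
by apply: IH => x xs; apply: h; rewrite inE xs orbT.
Qed.
End Tmeet.

Definition distinct_pairs n := enum [pred p : 'I_n * 'I_n | p.1 != p.2].

(** The commutator of [a] and [b]; it is 0 in an orthomodular lattice
    exactly when [a] and [b] commute. *)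
Definition comm (A : bzalg) (a b : A) : A :=
  (a ⊔ b) ⊓ (a ⊔ kl b) ⊓ ((kl a ⊔ b) ⊓ (kl a ⊔ kl b)).

Definition tcomm (X : Type) (x y : X) : term X :=
  let a := TVar x in let b := TVar y in
  TMeet (TMeet (TJoin a b) (TJoin a (TKl b)))
    (TMeet (TJoin (TKl a) b) (TJoin (TKl a) (TKl b))).

Definition tcomms n : term 'I_n :=
  tmeet (fun p => tcomm p.1 p.2) (distinct_pairs n).

Section Comms.
Variables (A : bzalg) (bi : bi_lattice A) (n : nat) (v : 'I_n -> A) (z : A).
Let bl := bi_lat bi.

(** If one commutator is below some [z <= z'], then so is the meet [w] of
    all of them, whence [w <= z <= z' <= w']. *)
Lemma comms_low i j : i != j -> z ⊑ kl z -> comm (v i) (v j) ⊑ z ->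
  ev v (TMeet (tcomms n) (TKl (tcomms n))) = ev v (tcomms n).
Proof.
move=> ij zz cz; have wz : ev v (tcomms n) ⊑ z.
  apply: (le_trans bl _ cz).
  by apply: (@tmeet_le _ _ _ _ bl v _ (i, j)); rewrite mem_enum inE.
exact: (le_trans bl wz (le_trans bl zz (bi_anti bi wz))).
Qed.

Lemma comms_high : (forall i j, i != j -> z ⊑ comm (v i) (v j)) ->
  ev v (TMeet (tcomms n) (TKl (tcomms n))) = ev v (tcomms n) -> z ⊑ kl z.
Proof.
move=> hz ww; have zw : z ⊑ ev v (tcomms n).
  by apply: (le_tmeet bl) => -[i j]; rewrite mem_enum => /hz.
exact: (le_trans bl zw (le_trans bl ww (bi_anti bi zw))).
Qed.
End Comms.

Lemma MO_comm_bounds (I : eqType) (a b : MO I) :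
  a = bot \/ a = top -> comm a b = bot.
Proof. by move=> [->|->]; case: b => //= i c; rewrite /comm /= eqxx; case: c. Qed.

Lemma MO_comm_same (I : eqType) (i : I) b c :
  comm (mo_elt i b : MO I) (mo_elt i c) = bot.
Proof. by rewrite /comm /= eqxx; case: b c => -[] //=; rewrite ?eqxx. Qed.

Lemma MO_comm_distinct (I : eqType) (i j : I) b c : i != j ->
  comm (mo_elt i b : MO I) (mo_elt j c) = top.
Proof. by rewrite /comm /= => /negbTE ->. Qed.

Lemma ord_other n (i : 'I_n.+2) : exists j, i != j.
Proof.
by case: (eqVneq i ord0) => [->|ne]; [exists ord_max|exists ord0].
Qed.

Lemma MO_pigeonhole n (v : 'I_n.+2 -> MO 'I_n.+1) :
  exists i j, i != j /\ comm (v i) (v j) = bot.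
Proof.
have [[i vi]|nb] := pselect (exists i, v i = bot \/ v i = top).
  by have [j ij] := ord_other i; exists i, j; split=> //; exact: MO_comm_bounds.
(* The default is never taken, since no [v i] is a bound. *)
pose g i := if v i is mo_elt k _ then k else ord0.
have vg i : exists b, v i = mo_elt (g i) b.
  rewrite /g; case E : (v i) => [||k b]; last by exists b.
    by case: nb; exists i; left.
  by case: nb; exists i; right.
have : ~ injective g.
  by move/leq_card; rewrite !card_ord ltnn.
move/injectiveP/injectivePn => [i [j ij gij]]; exists i, j; split=> //.
case: (vg i) (vg j) => b -> [c ->]; rewrite gij; exact: MO_comm_same.
Qed.

Lemma ext_comm_bounds (I : eqType) (a b : ext (MO I)) :
  a = bot \/ a = top -> comm a b ⊑ ext_mid mo_bot.
Proof.
move=> [->|->]; case: b => //= -[||i c] //=; rewrite /comm /= ?eqxx //=; by case: c.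
Qed.

Lemma ext_pigeonhole n (v : 'I_n.+2 -> ext (MO 'I_n.+1)) :
  exists i j, i != j /\ comm (v i) (v j) ⊑ ext_mid mo_bot.
Proof.
have [[i vi]|nb] := pselect (exists i, v i = bot \/ v i = top).
  by have [j ij] := ord_other i; exists i, j; split=> //; exact: ext_comm_bounds.
(* The default is never taken, since no [v i] is a bound. *)
pose u i : MO 'I_n.+1 := if v i is ext_mid a then a else mo_bot.
have vu i : v i = ext_mid (u i).
  rewrite /u; case E : (v i) => [|k|] //.
    by case: nb; exists i; left.
  by case: nb; exists i; right.
have [i [j [ij uij]]] := MO_pigeonhole u; exists i, j; split=> //.
by rewrite !vu -[comm _ _]/(ext_mid (comm (u i) (u j))) uij.
Qed.

(** The identity [comms_eq n = tcomms n] says that the meet [w] of the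
    commutators of [n] variables satisfies [w <= w']. This form, rather than
    [w = 0], also makes sense in the extensions by a new bottom and top, where
    commutators of commuting middle elements are not 0. *)
Definition comms_eq n := TMeet (tcomms n) (TKl (tcomms n)).

Lemma MO_comms_sat n : sat (eq (MO 'I_n.+1)) (comms_eq n.+2) (tcomms n.+2).
Proof.
move=> A v eA; move: v; rewrite -eA => v {A eA}.
have [i [j [ij vij]]] := MO_pigeonhole v.
by apply: (comms_low (z := bot) _ ij); rewrite ?vij //; case: (MO_MOL 'I_n.+1) => -[].
Qed.

Lemma ext_MO_comms_sat n : sat (eq (ext (MO 'I_n.+1))) (comms_eq n.+2) (tcomms n.+2).
Proof.
move=> A v eA; move: v; rewrite -eA => v {A eA}.
have [i [j [ij vij]]] := ext_pigeonhole v.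
have pk := bz_pk (OML_BZL (MOL_OML (MO_MOL 'I_n.+1))).
have bi := pk_bi (bz_pk (AOL_BZL (ext_AOL pk))).
exact: (comms_low bi ij _ vij).
Qed.

Definition MO_atoms n (i : 'I_n) : MO 'I_n := mo_elt i true.
Definition ext_MO_atoms n (i : 'I_n) : ext (MO 'I_n) := ext_mid (mo_elt i true).

Lemma MO_comms_fail n :
  ev (@MO_atoms n) (comms_eq n) <> ev (@MO_atoms n) (tcomms n).
Proof.
case: (MO_MOL 'I_n) => -[bi _] _ _.
move/(comms_high bi (z := top)) => h; suff: top ⊑ kl (top : MO 'I_n) by [].
by apply: h => i j ij; rewrite /MO_atoms MO_comm_distinct.
Qed.

Lemma MO_pk (I : eqType) : pseudo_kleene (MO I).
Proof. exact: bz_pk (OML_BZL (MOL_OML (MO_MOL I))). Qed.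

Lemma ext_MO_AOL (I : eqType) : AOL (ext (MO I)).
Proof. exact: ext_AOL (MO_pk I). Qed.

Lemma ext_MO_comms_fail n :
  ev (@ext_MO_atoms n) (comms_eq n) <> ev (@ext_MO_atoms n) (tcomms n).
Proof.
have bi := pk_bi (bz_pk (AOL_BZL (ext_MO_AOL 'I_n))).
move/(comms_high bi (z := (ext_mid mo_top : ext (MO 'I_n)))) => h.
suff: (ext_mid mo_top : ext (MO 'I_n)) ⊑ kl (ext_mid mo_top : ext (MO 'I_n)) by [].
apply: h => i j ij; rewrite /ext_MO_atoms.
rewrite -[comm _ _]/(ext_mid (comm (mo_elt i true : MO 'I_n) (mo_elt j true))).
by rewrite MO_comm_distinct.
Qed.

Definition tsym (X : Type) (x : X) : term X := TMeet (TVar x) (TKl (TVar x)).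

(** In an algebra with trivial Brouwer complement this term takes the
    value 1 if the elements [x /\ x'] are nonzero and pairwise disjoint, and 0
    otherwise. *)
Definition tdisjoint n : term 'I_n :=
  TMeet (tmeet (fun p => TBr (TMeet (tsym p.1) (tsym p.2))) (distinct_pairs n))
        (tmeet (fun i => TBr (TBr (tsym i))) (enum 'I_n)).

Lemma tdisjoint_OML n : sat OML (tdisjoint n.+1) TBot.
Proof.
move=> A v oA; have bz := OML_BZL oA; have bl := bi_lat (pk_bi (bz_pk bz)).
apply: (le_bot bl); apply: (le_trans bl (meet_ler bl _ _)).
have := @tmeet_le _ _ (fun i => TBr (TBr (tsym i))) A bl v (enum 'I_n.+1) ord0.
rewrite mem_enum => /(_ isT) /=.
by case: oA => ol _ _; rewrite ortho_meet_kl // br_bot // br_top.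
Qed.

Section PowSumDisjoint.
Variable I : Type.

Lemma pow_sum_sym (p : pow_sum I) i : (sval (p ⊓ kl p)).2 i = true.
Proof. by have := glued_cover p i; rewrite /= /pjoin orbC. Qed.

(** If the value is not 0, the elements [x /\ x'] are pairwise
    disjoint nonempty sets, and choosing a point in each is injective. *)
Lemma tdisjoint_ev n (v : 'I_n.+1 -> pow_sum I) : ev v (tdisjoint n.+1) <> bot ->
  exists g : 'I_n.+1 -> I, injective g.
Proof.
set y := fun i => v i ⊓ kl (v i).
have aA := pow_sum_AOL I; have bl := @pow_sum_lattice I => nb.
have disj i j : i != j -> y i ⊓ y j = bot.
  move=> ij; apply: contrapT => yij; apply: nb; apply: (le_bot bl).
  apply: (le_trans bl (meet_lel bl _ _)).
  have := @tmeet_le _ _ (fun p => TBr (TMeet (tsym p.1) (tsym p.2))) _ bl v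
    (distinct_pairs n.+1) (i, j).
  rewrite mem_enum => /(_ ij) h; have {h} : _ ⊑ br (y i ⊓ y j) := h.
  by case: aA => _ _ ->.
have nz i : exists k, (sval (y i)).1 k.
  apply: contrapT => nk; apply: nb; apply: (le_bot bl).
  have yi : y i = bot.
    apply: glued_inj => k; last exact: pow_sum_sym.
    by apply/negbTE/negP => yk; apply: nk; exists k.
  apply: (le_trans bl (meet_ler bl _ _)).
  have := @tmeet_le _ _ (fun i => TBr (TBr (tsym i))) _ bl v (enum 'I_n.+1) i.
  rewrite mem_enum => /(_ isT) h; have {h} : _ ⊑ br (br (y i)) := h.
  by have bz := AOL_BZL aA; rewrite yi br_bot // br_top.
pose g i := projT1 (cid (nz i)).
have yg i : (sval (y i)).1 (g i) by rewrite /g; case: cid.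
exists g => i j gij; apply: contrapT => /eqP ij.
have := congr1 (fun p : pow_sum I => (sval p).1 (g i)) (disj _ _ ij).
have -> : (sval (y i ⊓ y j)).1 (g i) = (sval (y i)).1 (g i) && (sval (y j)).1 (g i) by [].
by rewrite yg gij yg.
Qed.
End PowSumDisjoint.

Lemma tdisjoint_pow_sum n : sat (eq (pow_sum 'I_n.+1)) (tdisjoint n.+2) TBot.
Proof.
move=> A v eA; move: v; rewrite -eA => v {A eA}.
apply: contrapT => /tdisjoint_ev [g /leq_card].
by rewrite !card_ord ltnn.
Qed.

Definition pow_sum_atoms n (i : 'I_n) : pow_sum 'I_n :=
  exist _ (fun j => i == j, @p1 _) (or_intror erefl).

Lemma tdisjoint_fail n : ev (@pow_sum_atoms n.+1) (tdisjoint n.+1) <> bot.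
Proof.
have bl := @pow_sum_lattice 'I_n.+1; have bz := AOL_BZL (pow_sum_AOL 'I_n.+1).
set v := @pow_sum_atoms n.+1.
have symE i : ev v (tsym i) = v i.
  by apply: glued_inj => j //=; rewrite /pmeet /p1 andbT.
suff -> : ev v (tdisjoint n.+1) = top.
  move=> e; have := congr1 (fun p : pow_sum 'I_n.+1 => (sval p).1 ord0) e.
  by [].
apply: (le_anti bl); first exact: (bl_top bl).
apply: (le_meet bl); apply: (le_tmeet bl).
  move=> [i j]; rewrite mem_enum => ij.
  rewrite -[ev _ _]/(br (ev v (tsym i) ⊓ ev v (tsym j))) !symE.
  suff -> : v i ⊓ v j = bot by rewrite (br_bot bz) (meet_id bl).
  apply: glued_inj => k //; apply/negbTE/negP => /andP[/eqP ik /eqP jk].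
  by case/negP: ij; rewrite /= ik jk.
move=> i _; rewrite -[ev v (TBr _)]/(br (br (ev v (tsym i)))) symE.
suff -> : br (v i) = bot by rewrite (br_bot bz) (meet_id bl).
case: (pow_sum_AOL 'I_n.+1) => _ _; apply => vi.
have := congr1 (fun p : pow_sum 'I_n.+1 => (sval p).1 i) vi.
by rewrite /= eqxx.
Qed.

(** * Small algebras *)

Lemma pow_sum2_DIST J : DIST (pow_sum2 J).
Proof. apply: pow_sum2_embed DIST_variety _; exact: pow_sum_DIST. Qed.

(** The two-element algebra lies in every nontrivial variety of
    BZ-lattices, in particular in those of modular ortholattices and of
    distributive PBZ*-lattices. *)
Lemma D2_BA : BA (D 2).
Proof.
have MB : subvariety MOL BZL by split; [exact: MOL_variety|move=> A /MOL_OML/OML_BZL].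
have DB : subvariety DIST BZL by split; [exact: DIST_variety|exact: DIST_BZL].
case: (nontrivial_D2 MB) => [|ol _ hk].
  exists (MO nat); split; first exact: MO_MOL.
  by move/(_ bot top).
case: (nontrivial_D2 DB) => // .
exists (pow_sum nat); split; first exact: pow_sum_DIST.
by move/(_ bot top)/(congr1 (fun p : pow_sum nat => (sval p).1 0)).
Qed.

Lemma BA_BZL : subvariety BA BZL.
Proof. by split; [exact: BA_variety|move=> A /BA_DIST/DIST_BZL]. Qed.

Lemma VBZL1_D2 : VBZL1 (D 2) = BA.
Proof.
apply: classext; first exact: VBZL1_min BA_BZL D2_BA.
apply: BA_sub; [exact: VBZL_variety|exact: VBZL1_gen].
Qed.

Definition D3_map (i : D 3) : pow_sum 'I_1 :=
  match val i with
  | 0 => bot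
  | 1 => exist _ (@p1 _, @p1 _) (or_introl erefl)
  | _ => top
  end.

Definition D4_map (i : D 4) : pow_sum2 'I_1 :=
  match val i with
  | 0 => low (@p0 _)
  | 1 => low (@p1 _)
  | 2 => up (@p1 _)
  | _ => up (@p0 _)
  end.

Lemma I1_fun (x : 'I_1 -> bool) : x = @p0 _ \/ x = @p1 _.
Proof.
by case E : (x ord0); [right|left]; apply: funext => i; rewrite ord1 E.
Qed.

Lemma D3_map_hom : is_hom D3_map.
Proof.
have bl := @pow_sum_lattice 'I_1.
apply: chain_hom => //.
- move=> [[|[|[|//]]] ?] [[|[|[|//]]] ?] //= _; by apply: glued_inj.
- move=> [[|[|[|//]]] ?] //=; by apply: glued_inj.
- exact: br_bot (AOL_BZL (pow_sum_AOL _)).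
- move=> i ni; case: (pow_sum_AOL 'I_1) => _ _; apply.
  case: i ni => [[|[|[|//]]] ?] ni //=.
  + by case: ni; apply: val_inj.
  + by move/(congr1 (fun p : pow_sum 'I_1 => (sval p).1 ord0)).
  + by move/(congr1 (fun p : pow_sum 'I_1 => (sval p).1 ord0)).
Qed.

Lemma D4_map_hom : is_hom D4_map.
Proof.
have bz := DIST_BZL (pow_sum2_DIST 'I_1); have bl := bi_lat (pk_bi (bz_pk bz)).
apply: chain_hom => //.
- by move=> [[|[|[|[|//]]]] ?] [[|[|[|[|//]]]] ?].
- by move=> [[|[|[|[|//]]]] ?].
- exact: br_bot.
- move=> i ni; rewrite /= /trivial_br asboolF //.
  case: i ni => [[|[|[|[|//]]]] ?] ni //=.
  + by case: ni; apply: val_inj.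
  + by case=> /(congr1 (fun p => p ord0)).
Qed.

Lemma V_D3 : VBZL1 (D 3) = VBZL1 (pow_sum 'I_1).
Proof.
apply: classext; apply: VBZL1_sub.
- apply: (var_S (VBZL_variety _) D3_map_hom _ (@VBZL1_gen _)).
  move=> [[|[|[|//]]] ?] [[|[|[|//]]] ?] //= e; try exact: val_inj;
   have := congr1 (fun p : pow_sum 'I_1 => (sval p).1 ord0) e => //;
   by have := congr1 (fun p : pow_sum 'I_1 => (sval p).2 ord0) e.
- apply: (var_H (VBZL_variety _) D3_map_hom _ (@VBZL1_gen _)) => p.
  case: (svalP p); [case: (I1_fun (sval p).2)|case: (I1_fun (sval p).1)] => e1 e2.
  + by exists ord_max; apply: glued_inj => i; rewrite ?e1 ?e2.
  + by exists (inord 1); apply: glued_inj => i; rewrite /D3_map /= inordK // ?e1 ?e2.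
  + by exists ord0; apply: glued_inj => i; rewrite ?e1 ?e2.
  + by exists (inord 1); apply: glued_inj => i; rewrite /D3_map /= inordK // ?e1 ?e2.
Qed.

Lemma V_D4 : VBZL1 (D 4) = VBZL1 (pow_sum2 'I_1).
Proof.
have n01 : @p0 'I_1 <> @p1 _ by move/(congr1 (fun p => p ord0)).
apply: classext; apply: VBZL1_sub.
- apply: (var_S (VBZL_variety _) D4_map_hom _ (@VBZL1_gen _)).
  by move=> [[|[|[|[|//]]]] ?] [[|[|[|[|//]]]] ?] //= e; try exact: val_inj;
    case: e => /esym ? //; case: n01.
- apply: (var_H (VBZL_variety _) D4_map_hom _ (@VBZL1_gen _)) => -[x|x];
    case: (I1_fun x) => ->.
  + by exists ord0.
  + by exists (inord 1); rewrite /D4_map /= inordK.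
  + by exists ord_max.
  + by exists (inord 2); rewrite /D4_map /= inordK.
Qed.

Definition D4_ext_map (i : D 4) : ext (MO 'I_1) :=
  match val i with
  | 0 => ext_bot
  | 1 => ext_mid mo_bot
  | 2 => ext_mid mo_top
  | _ => ext_top
  end.

Lemma D4_ext_map_hom : is_hom D4_ext_map.
Proof.
have bz := AOL_BZL (ext_MO_AOL 'I_1); have bl := bi_lat (pk_bi (bz_pk bz)).
apply: chain_hom => //.
- by move=> [[|[|[|[|//]]]] ?] [[|[|[|[|//]]]] ?].
- by move=> [[|[|[|[|//]]]] ?].
- exact: br_bot.
- move=> i ni; rewrite /= /trivial_br asboolF //.
  by case: i ni => [[|[|[|[|//]]]] ?] ni //=; case: ni; apply: val_inj.
Qed.

Definition D4_elt k (hk : k < 4) : D 4 := Ordinal hk.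

(** The middle part of [ext (MO 'I_1)] is the four-element Boolean
    algebra, realized as the square of the middle pair of [D 4]. *)
Definition ext_D4_map (x : ext (MO 'I_1)) : prodalg (fun _ : bool => D 4) :=
  fun c => match x with
  | ext_bot => D4_elt (isT : 0 < 4)
  | ext_mid mo_bot => D4_elt (isT : 1 < 4)
  | ext_mid mo_top => D4_elt (isT : 2 < 4)
  | ext_mid (mo_elt _ b) => if b == c then D4_elt (isT : 1 < 4) else D4_elt (isT : 2 < 4)
  | ext_top => D4_elt (isT : 3 < 4)
  end.

Lemma ext_D4_map_hom : is_hom ext_D4_map.
Proof.
have br4 k (hk : k.+1 < 4) : br (D4_elt hk) = bot.
  by rewrite /= /trivial_br asboolF // => /(congr1 val).
have br40 : br (D4_elt (isT : 0 < 4)) = top.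
  by rewrite /= /trivial_br asboolT //; apply: val_inj.
split.
- move=> [|[||i b]|] [|[||j d]|] //=; apply: functional_extensionality_dep => c;
   apply: val_inj => //=; rewrite ?(ord1 i) ?(ord1 j) ?eqxx /=;
   try (case: b); try (case: d); by case: c.
- move=> [|[||i b]|] [|[||j d]|] //=; apply: functional_extensionality_dep => c;
   apply: val_inj => //=; rewrite ?(ord1 i) ?(ord1 j) ?eqxx /=;
   try (case: b); try (case: d); by case: c.
- move=> [|[||i b]|] //=; apply: functional_extensionality_dep => c;
   apply: val_inj => //=; try (case: b); by case: c.
- move=> x; apply: functional_extensionality_dep => c.
  rewrite [LHS]/ext_D4_map [RHS]/=.
  case: x => [|x|].
  + by rewrite [RHS]br40 /= /trivial_br asboolT //; apply: val_inj.
  + rewrite /= /trivial_br asboolF // asboolF; first exact: val_inj.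
    by case: x => [||i b]; try case: (b == c); move/(congr1 val).
  + rewrite /= /trivial_br asboolF // asboolF; first exact: val_inj.
    by move/(congr1 val).
- by apply: functional_extensionality_dep => c; apply: val_inj.
- by apply: functional_extensionality_dep => c; apply: val_inj.
Qed.

Lemma ext_D4_map_inj : injective ext_D4_map.
Proof.
move=> x y e; have et := congr1 (fun f => val (f true)) e.
have ef := congr1 (fun f => val (f false)) e; move: et ef => {e}.
by case: x y => [|[||i [] ]|] [|[||j [] ]|] //=; rewrite ?(ord1 i) ?(ord1 j).
Qed.

Lemma V_D4_ext : VBZL1 (D 4) = VBZL1 (ext (MO 'I_1)).
Proof.
apply: classext; apply: VBZL1_sub.
- apply: (var_S (VBZL_variety _) D4_ext_map_hom _ (@VBZL1_gen _)).
  by move=> [[|[|[|[|//]]]] ?] [[|[|[|[|//]]]] ?] //= e; exact: val_inj.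
- apply: (var_S (VBZL_variety _) ext_D4_map_hom ext_D4_map_inj).
  by apply: (var_P (VBZL_variety _)) => _; exact: VBZL1_gen.
Qed.

(** * Well-ordered chains of varieties *)

(** The part of [infinite_ascending_chain] that is inherited by
    subfamilies and by images under inclusion-preserving maps. *)
Definition well_chain (S : bzclass -> Prop) :=
  (forall K1 K2, S K1 -> S K2 -> subc K1 K2 \/ subc K2 K1) /\
  (forall P : bzclass -> Prop, (forall K, P K -> S K) -> (exists K, P K) ->
    exists K0, P K0 /\ forall K, P K -> subc K0 K).

Lemma subc_trans K1 K2 K3 : subc K1 K2 -> subc K2 K3 -> subc K1 K3.
Proof. by move=> h1 h2 A /h1/h2. Qed.

Lemma seq_mono (f : nat -> bzclass) : (forall n, subc (f n) (f n.+1)) ->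
  forall m n, m <= n -> subc (f m) (f n).
Proof.
move=> fS m n /subnK <-; elim: (n - m) => [//|k IH].
exact: subc_trans IH (fS _).
Qed.

Lemma seq_well_chain (f : nat -> bzclass) : (forall n, subc (f n) (f n.+1)) ->
  well_chain (fun K => exists n, K = f n).
Proof.
move=> /seq_mono fm; split.
  by move=> _ _ [m ->] [n ->]; case: (leqP m n) => [/fm|/ltnW/fm]; [left|right].
move=> P PS [K PK]; have ex : exists n, `[< P (f n) >].
  by case: (PS _ PK) => n Kn; exists n; apply/asboolP; rewrite -Kn.
case: (ex_minnP ex) => n /asboolP Pn nmin; exists (f n); split=> // K' PK'.
case: (PS _ PK') => m Km; rewrite Km; apply: fm; apply: nmin.
by apply/asboolP; rewrite -Km.
Qed.

Lemma top_well_chain S T : well_chain S -> (forall K, S K -> subc K T) ->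
  well_chain (fun K => S K \/ K = T).
Proof.
move=> [tot least] ST; split.
  move=> K1 K2 [S1|->] [S2|->]; [exact: tot|by left; apply: ST|by right; apply: ST|].
  by left.
move=> P PS [K PK]; have [[K1 [S1 P1]]|none] := pselect (exists K, S K /\ P K).
  case: (least (fun K => S K /\ P K)) => [? []//||K0 [[S0 P0] min0]].
    by exists K1.
  exists K0; split=> // K2 PK2; case: (PS _ PK2) => [S2|->]; last exact: ST.
  exact: min0.
exists T; have PT K2 : P K2 -> K2 = T.
  by move=> P2; case: (PS _ P2) => // S2; case: none; exists K2.
by split=> [|K2 /PT -> //]; rewrite -(PT _ PK).
Qed.

Lemma sub_well_chain (S S' : bzclass -> Prop) : (forall K, S' K -> S K) ->
  well_chain S -> well_chain S'.
Proof.
move=> SS [tot least]; split=> [K1 K2 /SS S1 /SS S2|P PS]; first exact: tot.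
by apply: least => K /PS/SS.
Qed.

Lemma join_well_chain C V : well_chain C -> well_chain (join_chain C V).
Proof.
move=> [tot least]; split.
  move=> _ _ [W1 [C1 ->]] [W2 [C2 ->]].
  by case: (tot _ _ C1 C2) => h; [left|right]; apply: vjoin_mono.
move=> P PS [K PK].
case: (least (fun W => C W /\ P (vjoin V W))) => [? []//||W0 [[CW0 P0] min0]].
  by case: (PS _ PK) => W [CW KE]; exists W; rewrite -KE.
exists (vjoin V W0); split=> // K2 PK2; case: (PS _ PK2) => W [CW KE].
by rewrite KE; apply: vjoin_mono => //; apply: min0; rewrite -KE.
Qed.

(** The algebras [A n] witness that the joins with the terms of the
    sequence [W] increase strictly. *)
Lemma infinite_chain C V (W : nat -> bzclass) (A : nat -> bzalg) :
  well_chain C -> (forall n, C (W n)) -> (forall n, subc (W n) (W n.+1)) ->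
  (forall n, W n.+1 (A n)) -> (forall n, ~ vjoin V (W n) (A n)) ->
  infinite_ascending_chain (join_chain C V).
Proof.
move=> wC CW WS WA nA; have [tot least] := join_well_chain V wC.
split=> //; exists (fun n => vjoin V (W n)); split=> n; first by exists (W n).
split; first exact: vjoin_mono.
by move=> e; apply: (nA n); rewrite e; apply: vjoin_r.
Qed.

Lemma vjoinC V W : vjoin V W = vjoin W V.
Proof.
by apply: classext; apply: VBZL_mono => A [h|h]; [right|left|right|left].
Qed.

Definition C0_seq (n : nat) : bzclass :=
  match n with 0 => TRIV | 1 => BA | n.+2 => VBZL1 (MO 'I_n.+1) end.

Definition C1_seq (n : nat) : bzclass :=
  match n with
  | 0 => TRIV | 1 => BA | 2 => VBZL1 (D 3) | 3 => VBZL1 (D 4)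
  | n.+4 => VBZL1 (ext (MO 'I_n.+1))
  end.

Definition C2_seq (n : nat) : bzclass :=
  match n with
  | 0 => TRIV | 1 => BA
  | n.+2 => if odd n then VBZL1 (pow_sum2 'I_n./2.+1) else VBZL1 (pow_sum 'I_n./2.+1)
  end.

Lemma MOL_BZL : subvariety MOL BZL.
Proof. by split; [exact: MOL_variety|move=> A /MOL_OML/OML_BZL]. Qed.

Lemma DIST_sub_BZL : subvariety DIST BZL.
Proof. by split; [exact: DIST_variety|exact: DIST_BZL]. Qed.

Lemma TRIV_sub_BA : subc TRIV BA.
Proof. exact: TRIV_sub BA_variety. Qed.

Lemma BA_VBZL1 A : BZL A -> (bot : A) <> top -> subc BA (VBZL1 A).
Proof.
move=> bA nt B bB V hV VA; apply: (BA_sub (proj1 hV)) => //.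
apply: nontrivial_D2 => //; exists A; split; first exact: VA.
by move/(_ bot top).
Qed.

Lemma MO_inj_sub (I J : eqType) (f : I -> J) : injective f ->
  subc (VBZL1 (MO I)) (VBZL1 (MO J)).
Proof.
move=> fi; apply: VBZL1_sub.
exact: (var_S (VBZL_variety _) (MO_map_hom fi) (MO_map_inj fi) (@VBZL1_gen _)).
Qed.

Lemma ext_MO_hom_sub (I J : eqType) (f : I -> J) : injective f ->
  subc (VBZL1 (ext (MO I))) (VBZL1 (ext (MO J))).
Proof.
move=> fi; apply: VBZL1_sub.
exact: (ext_embed (VBZL_variety _) (MO_map_hom fi) (MO_map_inj fi) (@VBZL1_gen _)).
Qed.

Lemma widen_ord_inj m n (h : m <= n) : injective (widen_ord h).
Proof. by move=> i j /(congr1 val) /= /val_inj. Qed.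

Lemma C0_seq_mono n : subc (C0_seq n) (C0_seq n.+1).
Proof.
case: n => [|[|n]]; first exact: TRIV_sub_BA.
  exact: BA_VBZL1 (OML_BZL (MOL_OML (MO_MOL _))) _.
exact: MO_inj_sub (@widen_ord_inj _ _ (leqnSn _)).
Qed.

Lemma MO_sub_MOL (I : eqType) : subc (VBZL1 (MO I)) MOL.
Proof. exact: VBZL1_min MOL_BZL (MO_MOL I). Qed.

Lemma C0_well_chain : well_chain C0.
Proof.
apply: (@sub_well_chain (fun K => ((exists n, K = C0_seq n) \/
  K = VBZL1 (MO nat)) \/ K = MOL)).
  move=> K [->|[->|[[[|n] [// _ ->]]|[->|->]]]].
  - by left; left; exists 0.
  - by left; left; exists 1.
  - by left; left; exists n.+2.
  - by left; right.
  - by right.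
have seq_nat n : subc (C0_seq n) (VBZL1 (MO nat)).
  apply: (subc_trans (seq_mono C0_seq_mono (leq_addr 2 n))); rewrite addn2.
  exact: MO_inj_sub (@ord_inj _).
apply: top_well_chain; last first.
  by move=> K [[n ->]|->]; [apply: subc_trans (seq_nat n) _|]; exact: MO_sub_MOL.
apply: top_well_chain; first exact: seq_well_chain C0_seq_mono.
by move=> K [n ->]; exact: seq_nat.
Qed.

Lemma C0_sub_MOL K : C0 K -> subc K MOL.
Proof.
move=> [->|[->|[[n [_ ->]]|[->|->]]]] //; try exact: MO_sub_MOL; last exact: BA_MOL.
exact: subc_trans TRIV_sub_BA BA_MOL.
Qed.

Lemma C1_seq_mono n : subc (C1_seq n) (C1_seq n.+1).
Proof.
case: n => [|[|[|[|n]]]]; first exact: TRIV_sub_BA.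
- rewrite /= V_D3; apply: BA_VBZL1 (AOL_BZL (pow_sum_AOL _)) _.
  by move/(congr1 (fun p : pow_sum 'I_1 => (sval p).1 ord0)).
- rewrite /= V_D3 V_D4; apply: VBZL1_sub.
  exact: (pow_sum_quotient ord0 (VBZL_variety _) (@VBZL1_gen _)).
- by rewrite /= V_D4_ext.
- exact: ext_MO_hom_sub (@widen_ord_inj _ _ (leqnSn _)).
Qed.

Lemma ext_MO_in_ext_MOL (I : eqType) : VBZL (ext_class MOL) (ext (MO I)).
Proof. by apply: VBZL_gen; exists (MO I); split=> //; exact: MO_MOL. Qed.

Lemma C1_seq_nat n : subc (C1_seq n) (VBZL1 (ext (MO nat))).
Proof.
apply: (subc_trans (seq_mono C1_seq_mono (leq_addr 4 n))); rewrite addn4.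
exact: ext_MO_hom_sub (@ord_inj _).
Qed.

Lemma C1_cases K : C1 K ->
  ((exists n, K = C1_seq n) \/ K = VBZL1 (ext (MO nat))) \/ K = VBZL (ext_class MOL).
Proof.
move=> [->|[->|[->|[->|[[[|n] [// _ ->]]|[->|->]]]]]].
- by left; left; exists 0.
- by left; left; exists 1.
- by left; left; exists 2.
- by left; left; exists 3.
- by left; left; exists n.+4.
- by left; right.
- by right.
Qed.

Lemma C1_sub_ext_MOL K : C1 K -> subc K (VBZL (ext_class MOL)).
Proof.
have e := VBZL1_sub (ext_MO_in_ext_MOL nat).
move/C1_cases => [[[n ->]|->]|->] //; exact: (subc_trans (@C1_seq_nat n) e).
Qed.

Lemma C1_well_chain : well_chain C1.
Proof.
apply: sub_well_chain C1_cases _.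
apply: top_well_chain; last first.
  have e := VBZL1_sub (ext_MO_in_ext_MOL nat).
  by move=> K [[n ->]|->] //; exact: (subc_trans (@C1_seq_nat n) e).
apply: top_well_chain; first exact: seq_well_chain C1_seq_mono.
by move=> K [n ->]; exact: C1_seq_nat.
Qed.

Lemma pow_sum_surj_sub (I J : Type) (f : I -> J) : (forall j, exists i, f i = j) ->
  subc (VBZL1 (pow_sum J)) (VBZL1 (pow_sum I)).
Proof.
by move=> fs; apply: VBZL1_sub; exact: (pow_sum_embed fs (VBZL_variety _) (@VBZL1_gen _)).
Qed.

Lemma pow_sum2_surj_sub (I J : Type) (f : I -> option J) : (forall j, exists i, f i = j) ->
  subc (VBZL1 (pow_sum2 J)) (VBZL1 (pow_sum I)).
Proof.
move=> fs; apply: VBZL1_sub; apply: (pow_sum2_embed (VBZL_variety _)).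
exact: (pow_sum_embed fs (VBZL_variety _) (@VBZL1_gen _)).
Qed.

Lemma pow_sum_sub_pow_sum2 J : J -> subc (VBZL1 (pow_sum J)) (VBZL1 (pow_sum2 J)).
Proof.
move=> j; apply: VBZL1_sub.
exact: (pow_sum_quotient j (VBZL_variety _) (@VBZL1_gen _)).
Qed.

Lemma C2_seq_mono n : subc (C2_seq n) (C2_seq n.+1).
Proof.
case: n => [|[|n]]; first exact: TRIV_sub_BA.
  apply: BA_VBZL1 (AOL_BZL (pow_sum_AOL _)) _.
  by move/(congr1 (fun p : pow_sum 'I_1 => (sval p).1 ord0)).
rewrite /= uphalf_half; case: (odd n) => /=; last exact: pow_sum_sub_pow_sum2 ord0.
(* 'I_(n + 1) is 'I_n with [ord_max] in the role of [None]. *)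
apply: (@pow_sum2_surj_sub _ _ (fun i => unlift ord_max i)) => -[j|].
  by exists (lift ord_max j); rewrite liftK.
by exists ord_max; rewrite unlift_none.
Qed.

Lemma ord_surj n (j : 'I_n.+1) : exists i, inord i = j.
Proof. by exists (val j); rewrite inord_val. Qed.

Lemma pow_sum_nat_sub n : subc (C2_seq n) (VBZL1 (pow_sum nat)).
Proof.
apply: (subc_trans (seq_mono C2_seq_mono (leq_addl n.+2 n))).
rewrite addSn addSn /= addnn odd_double.
exact: pow_sum_surj_sub (@ord_surj _).
Qed.

Lemma C2_cases K : C2 K -> (((exists n, K = C2_seq n) \/ K = VBZL1 (pow_sum nat)) \/
  K = VBZL1 (pow_sum2 nat)) \/ K = DIST.
Proof.
move=> [->|[->|[[[|n] [// _ [->|->]]]|[->|[->|->]]]]].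
- by left; left; left; exists 0.
- by left; left; left; exists 1.
- by left; left; left; exists (n.*2).+2; rewrite /= odd_double doubleK.
- by left; left; left; exists (n.*2).+3; rewrite /= odd_double uphalf_double.
- by left; left; right.
- by left; right.
- by right.
Qed.

Lemma C2_sub_DIST K : C2 K -> subc K DIST.
Proof.
have h0 := VBZL1_min DIST_sub_BZL (pow_sum_DIST nat).
have h1 := VBZL1_min DIST_sub_BZL (pow_sum2_DIST nat).
by move/C2_cases => [[[[n ->]|->]|->]|->] //; exact: (subc_trans (@pow_sum_nat_sub n) h0).
Qed.

Lemma C2_well_chain : well_chain C2.
Proof.
have h0 := VBZL1_min DIST_sub_BZL (pow_sum_DIST nat).
have h1 := VBZL1_min DIST_sub_BZL (pow_sum2_DIST nat).
have h2 := @pow_sum_sub_pow_sum2 nat 0.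
apply: sub_well_chain C2_cases _.
apply: top_well_chain; last first.
  by move=> K [[[n ->]|->]|->] //; exact: (subc_trans (@pow_sum_nat_sub n) h0).
apply: top_well_chain; last first.
  by move=> K [[n ->]|->] //; exact: (subc_trans (@pow_sum_nat_sub n) h2).
apply: top_well_chain; first exact: seq_well_chain C2_seq_mono.
by move=> K [n ->]; exact: pow_sum_nat_sub.
Qed.

Lemma sat_VBZL1 A (X : Type) (s t : term X) : BZL A -> sat (eq A) s t ->
  sat (VBZL1 A) s t.
Proof. by move=> bA st; apply: VBZL_sat => [_ -> //|B v BA]; apply: st. Qed.

Lemma brouwer_boolean_sub W W' : subc W' W -> brouwer_boolean W -> brouwer_boolean W'.
Proof.
move=> WW [WB h]; split=> [|X s t st A v /WW WA]; first exact: subc_trans WB.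
exact: h.
Qed.

(** * Joins with the chains *)

Section JoinC0.
Variables (V : bzclass) (hV : subvariety V (VBZL AOL)) (ntV : nontrivial V).

(** [MO (n + 2)] is orthomodular, so membership in the join would put
    it into the variety of [MO (n + 1)]. *)
Lemma MO_notin_join n : ~ vjoin V (VBZL1 (MO 'I_n.+1)) (MO 'I_n.+2).
Proof.
rewrite vjoinC => h.
have bM k : BZL (MO 'I_k) by exact: OML_BZL (MOL_OML (MO_MOL _)).
have: VBZL1 (MO 'I_n.+1) (MO 'I_n.+2).
  apply: (OML_part_of_join _ _ _ _ h); last exact: MOL_OML (MO_MOL _).
  - by split; [exact: VBZL_variety|move=> A /MO_sub_MOL/MOL_OML].
  - by exists (MO 'I_n.+1); split; [exact: VBZL1_gen|move/(_ bot top)].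
  - exact: brouwer_boolean_sub (proj2 hV) VAOL_brouwer_boolean.
move=> h1; apply: (@MO_comms_fail n.+2).
exact: (sat_VBZL1 (bM _) (@MO_comms_sat n) _ h1).
Qed.

Lemma C0_join_chain :
  infinite_ascending_chain_in (vjoin MOL (VBZL AOL)) (join_chain C0 V).
Proof.
split.
  apply: (infinite_chain (W := fun n => VBZL1 (MO 'I_n.+1))
    (A := fun n => MO 'I_n.+2)) => [|n|n|n|n].
  - exact: C0_well_chain.
  - by right; right; left; exists n.+1.
  - exact: (@C0_seq_mono n.+2).
  - exact: VBZL1_gen.
  - exact: MO_notin_join.
move=> _ [W [CW ->]]; split; first exact: vjoin_variety.
by rewrite vjoinC; apply: vjoin_mono; [exact: C0_sub_MOL|case: hV].
Qed.
End JoinC0.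

Lemma C0_join_disjoint V W : subvariety V (VBZL AOL) -> nontrivial V ->
  subvariety W (VBZL AOL) -> nontrivial W -> V <> W ->
  disjoint_families (join_chain C0 V) (join_chain C0 W).
Proof.
move=> hV ntV hW ntW VW K [[W1 [C1 e1]] [W2 [C2 e2]]]; apply: VW.
have O1 : subc W1 OML by move=> A /(C0_sub_MOL C1)/MOL_OML.
have O2 : subc W2 OML by move=> A /(C0_sub_MOL C2)/MOL_OML.
apply: classext => A hA.
  apply: (VAOL_part_of_join hW ntW O2 (proj2 hV _ hA)).
  by rewrite -e2 e1; exact: vjoin_l.
apply: (VAOL_part_of_join hV ntV O1 (proj2 hW _ hA)).
by rewrite -e1 e2; exact: vjoin_l.
Qed.

Lemma ext_MOL_in : subc (ext_class MOL) (capc MOD SAOL).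
Proof.
move=> _ [K [mK ->]]; have pk := bz_pk (OML_BZL (MOL_OML mK)).
have aA := ext_AOL pk; have [pA _ _] := aA.
split; first by split=> //; apply: ext_modular (bi_lat (pk_bi pk)) _; case: mK.
by split; [exact: ext_SDM|exact: VBZL_gen].
Qed.

Lemma ext_MOL_VAOL : subc (VBZL (ext_class MOL)) (VBZL AOL).
Proof.
apply: VBZL_mono => _ [K [mK ->]]; apply: ext_AOL.
exact: bz_pk (OML_BZL (MOL_OML mK)).
Qed.

Lemma C1_brouwer_boolean K : C1 K -> brouwer_boolean K.
Proof.
move=> /C1_sub_ext_MOL h; apply: brouwer_boolean_sub VAOL_brouwer_boolean.
exact: subc_trans h ext_MOL_VAOL.
Qed.

Lemma C2_brouwer_boolean K : C2 K -> brouwer_boolean K.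
Proof. by move=> /C2_sub_DIST h; apply: brouwer_boolean_sub DIST_brouwer_boolean. Qed.

Lemma OML_join_disjoint U Y C C' : subvariety U OML -> nontrivial U ->
  subvariety Y OML -> nontrivial Y -> U <> Y ->
  (forall K, C K -> brouwer_boolean K) -> (forall K, C' K -> brouwer_boolean K) ->
  disjoint_families (join_chain C U) (join_chain C' Y).
Proof.
move=> hU ntU hY ntY UY bC bC' K [[W1 [/bC C1 e1]] [W2 [/bC' C2 e2]]]; apply: UY.
apply: classext => A hA.
  apply: (OML_part_of_join hY ntY C2 (proj2 hU _ hA)).
  by rewrite -e2 e1; exact: vjoin_l.
apply: (OML_part_of_join hU ntU C1 (proj2 hY _ hA)).
by rewrite -e1 e2; exact: vjoin_l.
Qed.

Section JoinC1C2.
Variables (U : bzclass) (hU : subvariety U OML).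

Lemma ext_MO_notin_join n :
  ~ vjoin U (VBZL1 (ext (MO 'I_n.+1))) (ext (MO 'I_n.+2)).
Proof.
rewrite vjoinC => h; apply: (@ext_MO_comms_fail n.+2).
have bM k : BZL (ext (MO 'I_k)) by exact: AOL_BZL (ext_MO_AOL _).
apply: (AOL_unsharp_identity (x := ord0) _ (proj2 hU) _ (ext_MO_AOL _) h) => //.
  by apply: VBZL_BZL => A ->.
exact: sat_VBZL1 (bM _) (@ext_MO_comms_sat n).
Qed.

(** Two complementary atoms of the middle part and a third one
    violate distributivity, and atoms of the middle part are nonsharp. *)
Lemma ext_MO2_notin_DIST : ~ vjoin U DIST (ext (MO 'I_2)).
Proof.
rewrite vjoinC => h; pose a i b : ext (MO 'I_2) := ext_mid (mo_elt i b).
pose v := env (a ord0 true) (a ord0 false) (a ord_max true).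
suff: ev v distributive_eq.1 = ev v distributive_eq.2 by [].
apply: (AOL_unsharp_identity (x := 0) DIST_BZL (proj2 hU) _ (ext_MO_AOL _) h) => //.
by move=> A w [_ hd]; exact: hd.
Qed.

Lemma pow_sum_notin_join n :
  ~ vjoin U (VBZL1 (pow_sum 'I_n.+1)) (pow_sum 'I_n.+2).
Proof.
have bP k : BZL (pow_sum 'I_k) by exact: AOL_BZL (pow_sum_AOL _).
move=> h; apply: (@tdisjoint_fail n.+1).
apply: (vjoin_sat (t := TBot) _ _ _ _ _ h).
- by move=> A /(proj2 hU)/OML_BZL.
- by apply: VBZL_BZL => A ->.
- by move=> A w /(proj2 hU); exact: tdisjoint_OML.
- exact: sat_VBZL1 (bP _) (@tdisjoint_pow_sum n).
Qed.

Lemma C1_join_chain :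
  infinite_ascending_chain_in (vjoin OML (capc MOD SAOL)) (join_chain C1 U).
Proof.
split.
  apply: (infinite_chain (W := fun n => VBZL1 (ext (MO 'I_n.+1)))
    (A := fun n => ext (MO 'I_n.+2))) => [|n|n|n|n].
  - exact: C1_well_chain.
  - by do 4 right; left; exists n.+1.
  - exact: (@C1_seq_mono n.+4).
  - exact: VBZL1_gen.
  - exact: ext_MO_notin_join.
move=> _ [W [CW ->]]; split; first exact: vjoin_variety.
apply: (@subc_trans _ (vjoin OML (VBZL (ext_class MOL)))).
  by apply: vjoin_mono; [case: hU|exact: C1_sub_ext_MOL].
move=> A hA V hV sV; apply: hA => // B [OB|]; first by apply: sV; left.
by apply; [|move=> C /ext_MOL_in MC; apply: sV; right].
Qed.

Lemma C2_join_chain :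
  infinite_ascending_chain_in (vjoin OML DIST) (join_chain C2 U).
Proof.
split.
  apply: (infinite_chain (W := fun n => VBZL1 (pow_sum 'I_n.+1))
    (A := fun n => pow_sum 'I_n.+2)) => [|n|n|n|n].
  - exact: C2_well_chain.
  - by right; right; left; exists n.+1; split=> //; left.
  - by apply: (@pow_sum_surj_sub _ _ (fun i : 'I_n.+2 => inord i)) => j;
      exists (inord j); rewrite inordK ?inord_val // ltnS ltnW.
  - exact: VBZL1_gen.
  - exact: pow_sum_notin_join.
move=> _ [W [CW ->]]; split; first exact: vjoin_variety.
by apply: vjoin_mono; [case: hU|exact: C2_sub_DIST].
Qed.

Hypothesis ntU : nontrivial U.

Lemma join_BA : vjoin U BA = U.
Proof.
have hU' := subvariety_trans hU OML_BZL.
apply: vjoin_absorb => //; apply: (BA_sub (proj1 hU)); exact: nontrivial_D2.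
Qed.

Lemma join_TRIV : vjoin U TRIV = U.
Proof.
apply: vjoin_absorb (subvariety_trans hU OML_BZL) _.
exact: TRIV_sub (proj1 hU).
Qed.

(** The term of index 5 is the variety of [ext (MO 'I_2)]. *)
Lemma C1_ext_MO2_or_small K : C1 K ->
  K (ext (MO 'I_2)) \/ exists2 n, n < 5 & K = C1_seq n.
Proof.
move/C1_cases => [[[n ->]|->]|->].
- case: (ltnP n 5) => h; first by right; exists n.
  by left; apply: (seq_mono C1_seq_mono h); exact: VBZL1_gen.
- by left; apply: (@C1_seq_nat 5); exact: VBZL1_gen.
- by left; exact: ext_MO_in_ext_MOL.
Qed.

Lemma C1_C2_common K : (join_chain C1 U K /\ join_chain C2 U K) <->
  (K = vjoin U (VBZL1 (D 2)) \/ K = vjoin U (VBZL1 (D 3)) \/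
   K = vjoin U (VBZL1 (D 4))).
Proof.
split.
  move=> [[W1 [C1W e1]] [W2 [C2W e2]]].
  case: (C1_ext_MO2_or_small C1W) => [h|[n n5 W1E]].
    case: ext_MO2_notin_DIST; have: K (ext (MO 'I_2)) by rewrite e1; exact: vjoin_r.
    by rewrite e2; apply: vjoin_mono => //; exact: C2_sub_DIST.
  move: e1; rewrite W1E; case: n n5 {W1E} => [|[|[|[|[|//]]]]] _ /= ->.
  - by left; rewrite VBZL1_D2 join_TRIV join_BA.
  - by left; rewrite VBZL1_D2.
  - by right; left.
  - by right; right.
  - by right; right; rewrite V_D4_ext.
move=> [->|[->|->]]; split; eexists; split; try reflexivity.
- by right; left; exact: VBZL1_D2.
- by right; left; exact: VBZL1_D2.
- by right; right; left.
- by right; right; left; exists 1; split=> //; left; exact: V_D3.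
- by right; right; right; left.
- by right; right; left; exists 1; split=> //; right; exact: V_D4.
Qed.
End JoinC1C2.

Theorem mainTheorem12 (V W U Y : bzclass)
  (hV : subvariety V (VBZL AOL)) (hW : subvariety W (VBZL AOL))
  (hU : subvariety U OML) (hY : subvariety Y OML)
  (ntV : nontrivial V) (ntW : nontrivial W)
  (ntU : nontrivial U) (ntY : nontrivial Y)
  (neVW : V <> W) (neUY : U <> Y) :
  (infinite_ascending_chain_in (vjoin MOL (VBZL AOL)) (join_chain C0 V) /\
   infinite_ascending_chain_in (vjoin MOL (VBZL AOL)) (join_chain C0 W) /\
   disjoint_families (join_chain C0 V) (join_chain C0 W)) /\
  (infinite_ascending_chain_in (vjoin OML (capc MOD SAOL)) (join_chain C1 U) /\
   infinite_ascending_chain_in (vjoin OML (capc MOD SAOL)) (join_chain C1 Y) /\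
   disjoint_families (join_chain C1 U) (join_chain C1 Y)) /\
  (infinite_ascending_chain_in (vjoin OML DIST) (join_chain C2 U) /\
   infinite_ascending_chain_in (vjoin OML DIST) (join_chain C2 Y) /\
   disjoint_families (join_chain C2 U) (join_chain C2 Y)) /\
  (disjoint_families (join_chain C1 U) (join_chain C2 Y) /\
   vjoin U (VBZL1 (D 2)) = vjoin U BA /\ vjoin U BA = U /\
   (forall K, (join_chain C1 U K /\ join_chain C2 U K) <->
      (K = vjoin U (VBZL1 (D 2)) \/ K = vjoin U (VBZL1 (D 3)) \/
       K = vjoin U (VBZL1 (D 4))))).
Proof.
have b1 := C1_brouwer_boolean; have b2 := C2_brouwer_boolean.
split; first by split; [|split]; [exact: C0_join_chain..|exact: C0_join_disjoint].
split; first by split; [|split]; [exact: C1_join_chain..|exact: OML_join_disjoint].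
split; first by split; [|split]; [exact: C2_join_chain..|exact: OML_join_disjoint].
split; first exact: OML_join_disjoint.
split; first by rewrite VBZL1_D2.
split; [exact: join_BA|exact: C1_C2_common].
Qed.
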